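(* Let $m\ge1$ be an integer, let $k$ be a field whose characteristic is zero or does not divide the order of $D_{2m+1}$, and let $\mathcal Q_{D_{2m+1}}$ be the quiver of the invariant subalgebra $(k\mathcal F)^{D_{2m+1}}$ of the face semigroup algebra $k\mathcal F$ of the reflection arrangement of $D_{2m+1}$. Then the length of the longest path in $\mathcal Q_{D_{2m+1}}$ is at most $m+1$.
   Context: Coxeter group of type $D$. For $n\in\mathbb N$ let $[n]=\{1,\dots,n\}$ and $[\pm n]=\{1,\dots,n\}\cup\{-1,\dots,-n\}$. A signed permutation is a permutation $w$ of $[\pm n]$ with $w(-i)=-w(i)$ for all $i\in[n]$; it acts on $\mathbb R^n$ by $w(v_1,\dots,v_n)=(v_{w^{-1}(1)},\dots,v_{w^{-1}(n)})$, where $v_{-i}=-v_i$. The group $D_n$ is the group of signed permutations that negate an even number of elements of $[n]$. Its reflection arrangement $\mathcal A$ consists of the hyperplanes $\{v\in\mathbb R^n: v_i=v_j\}$ with $i,j\in[\pm n]$, $i\ne j,-j$ (where $v_{-i}=-v_i$). Face semigroup algebra. For each $H\in\mathcal A$ let $H^+,H^-$ be the two open half spaces determined by $H$ (labels fixed arbitrarily) and $H^0=H$. A face of $\mathcal A$ is a non-empty intersection $x=\bigcap_{H\in\mathcal A}H^{\sigma_H(x)}$ with $\sigma_H(x)\in\{+,0,-\}$. The set $\mathcal F$ of faces is a semigroup with identity, where $xy$ is the face with $\sigma_H(xy)=\sigma_H(x)$ if $\sigma_H(x)\ne0$ and $\sigma_H(xy)=\sigma_H(y)$ if $\sigma_H(x)=0$.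 $k\mathcal F$ is its semigroup algebra. The reflection group $W$ of $\mathcal A$ permutes $\mathcal F$ and acts on $k\mathcal F$ by algebra automorphisms; $(k\mathcal F)^{W}=\{a\in k\mathcal F: w(a)=a\text{ for all }w\in W\}$. (By a theorem of Bidigare, $(k\mathcal F)^W$ is anti-isomorphic to the descent algebra of $W$.) It is known that $(k\mathcal F)^W$ is a split basic $k$-algebra. Quivers. A finite dimensional $k$-algebra $A$ is split basic if $A/\operatorname{rad}A$ is a direct product of copies of $k$, where $\operatorname{rad}A$ is the Jacobson radical. A complete system of primitive orthogonal idempotents of $A$ is a set of pairwise orthogonal primitive idempotents with sum $1_A$. The quiver of a split basic algebra $A$ is the finite directed graph whose vertex set is the index set $\mathcal I$ of such a system $\{e_v:v\in\mathcal I\}$, and in which the number of arrows $x\to y$ is $\dim_k e_y(\operatorname{rad}(A)/\operatorname{rad}^2(A))e_x$; up to isomorphism it does not depend on the system chosen. The length of a path is its number of arrows. *)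

(* Defs.v *)
From HB Require Import structures.
From mathcomp Require Import all_boot all_order all_algebra all_fingroup all_field.
From mathcomp Require Import boolp classical_sets.
From mathcomp Require Export reals.

Set Implicit Arguments.
Unset Strict Implicit.
Unset Printing Implicit Defensive.

Import Order.TTheory GRing.Theory Num.Theory.

Local Open Scope ring_scope.

(* The set [±n]: (i, false) stands for i and (i, true) for -i. *)
Notation sidx n := ('I_n * bool)%type.

Definition sneg n (a : sidx n) : sidx n := (a.1, ~~ a.2).

Lemma snegK n : involutive (@sneg n).
Proof. by case=> i b; rewrite /sneg /= negbK. Qed.

Definition signed_perm n (w : {perm sidx n}) : bool :=
  [forall a, w (sneg a) == sneg (w a)].

(* The elements of [n] that w sends to a negative number. *)
Definition negated n (w : {perm sidx n}) : {set 'I_n} :=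
  [set i | (w (i, false)).2].

Definition Dset n : {set {perm sidx n}} :=
  [set w | signed_perm w & ~~ odd #|negated w|].

Lemma signed_permP n (w : {perm sidx n}) :
  reflect (forall a, w (sneg a) = sneg (w a)) (signed_perm w).
Proof. by apply: (iffP forallP) => h a; apply/eqP/h. Qed.

Lemma signed_permM n (u w : {perm sidx n}) :
  signed_perm u -> signed_perm w -> signed_perm (u * w)%g.
Proof.
move=> /signed_permP hu /signed_permP hw; apply/signed_permP => a.
by rewrite !permM hu hw.
Qed.

Lemma signed_permV n (w : {perm sidx n}) : signed_perm w -> signed_perm w^-1%g.
Proof.
move=> /signed_permP hw; apply/signed_permP => a.
by apply: (@perm_inj _ w); rewrite hw !permKV.
Qed.

Lemma odd_negatedM n (u w : {perm sidx n}) : signed_perm u -> signed_perm w ->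
  odd #|negated (u * w)%g| = odd #|negated u| (+) odd #|negated w|.
Proof.
move=> /signed_permP hu /signed_permP hw.
have cardE (v : {perm sidx n}) : #|negated v| = (\sum_i (v (i, false)).2)%N.
  by rewrite -sum1_card big_mkcond; apply: eq_bigr => i _; rewrite inE; case: _.2.
have oddE (v : {perm sidx n}) :
    odd #|negated v| = \big[addb/false]_i (v (i, false)).2.
  by rewrite cardE (big_morph odd oddD (erefl _)); apply: eq_bigr => i _; case: _.2.
pose f i := (u (i, false)).1.
have finj : injective f.
  move=> i j; rewrite /f => eij.
  case: (u (i, false) =P u (j, false)) => [/perm_inj[] //|ne].
  have : u (i, false) = u (sneg (j, false)).
    rewrite hu; apply/eqP; move/eqP: ne eij.
    case: (u (i, false)) => a b; case: (u (j, false)) => c d /=.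
    rewrite /sneg /= !xpair_eqE => + eac; rewrite eac eqxx /=.
    by case: b; case: d.
  by move/perm_inj; case.
rewrite !oddE [X in _ (+) X](reindex_inj finj) /= -big_split /=; apply: eq_bigr => i _.
rewrite permM /f; case: (u (i, false)) => j [] //=.
by rewrite -[(j, true)]/(sneg (j, false)) hw.
Qed.

Lemma Dset_group_set n : group_set (Dset n).
Proof.
apply/group_setP; split.
  rewrite inE; apply/andP; split.
    by apply/signed_permP => a; rewrite !perm1.
  rewrite (_ : negated 1 = finset.set0) ?cards0 //.
  by apply/setP => i; rewrite !inE perm1.
move=> u w; rewrite !inE => /andP[su ou] /andP[sw ow].
by rewrite signed_permM // odd_negatedM // (negbTE ou) (negbTE ow).
Qed.

Canonical Dgroup n : {group {perm sidx n}} := Group (Dset_group_set n).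

Section Arrangement.

Variables (R : realFieldType) (n : nat).
Implicit Types (v : 'rV[R]_n) (a : sidx n) (w : {perm sidx n}).

(* v_a for a in [±n], with v_{-i} = - v_i. *)
Definition scoord v a : R := (-1) ^+ a.2 * v 0 a.1.

(* w(v)_i = v_{w^-1(i)} *)
Definition vact w v : 'rV[R]_n := \row_i scoord v ((w^-1)%g (i, false)).

(* Every hyperplane v_a = v_b (a, b in [±n], b <> a, -a) is v_i = v_j or
   v_i = v_{-j} for exactly one pair i < j in [n]; the index (i, (j, c)) stands
   for v_i = v_{(j, c)}, so that each hyperplane has exactly one index. *)
Definition hyp : Type := {h : 'I_n * sidx n | (h.1 < h.2.1)%N}.

HB.instance Definition _ := SubFinite.on hyp.

Definition hform (h : hyp) v : R :=
  scoord v ((val h).1, false) - scoord v (val h).2.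

(* H^0 = H, H^+ and H^-; the signs 0, +, - are None, Some true, Some false. *)
Definition side (h : hyp) (s : option bool) : set 'rV[R]_n :=
  match s with
  | None => [set v | hform h v = 0]%classic
  | Some true => [set v | 0 < hform h v]%classic
  | Some false => [set v | hform h v < 0]%classic
  end.

Definition signs := {ffun hyp -> option bool}.

Definition cone (sigma : signs) : set 'rV[R]_n :=
  (\bigcap_(h in [set: hyp]) side h (sigma h))%classic.

(* A face is given by its sign sequence; it is the nonempty set [cone sigma],
   and distinct sign sequences have disjoint cones. *)
Record face := Face {
  fsign :> signs;
  _ : `[< (cone fsign !=set0)%classic >]
}.

HB.instance Definition _ := [isSub for fsign].
HB.instance Definition _ := [Finite of face by <:].

Definition sgn (x : R) : option bool := if x == 0 then None else Some (0 < x).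

Definition vsigns v : signs := [ffun h => sgn (hform h v)].

Lemma sideP h s v : side h s v <-> s = sgn (hform h v).
Proof.
rewrite /sgn; case: s => [[]|] /=; case: (ltgtP (hform h v) 0) => hv;
  by split => // e; rewrite ?e ?ltxx // in hv *.
Qed.

Lemma coneP sigma v : cone sigma v <-> sigma = vsigns v.
Proof.
split=> [hs | -> h _]; last by apply/sideP; rewrite ffunE.
by apply/ffunP => h; rewrite ffunE; apply/sideP/hs.
Qed.

Lemma vsigns_face v : `[< (cone (vsigns v) !=set0)%classic >].
Proof. by apply/asboolP; exists v; apply/coneP. Qed.

(* The face that contains v. *)
Definition face_of v : face := Face (vsigns_face v).

Lemma face_nonempty (x : face) : exists v, cone x v.
Proof. by case: x => s /= /asboolP. Qed.

Definition face_pt (x : face) : 'rV[R]_n := sval (cid (face_nonempty x)).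

Lemma face_ptP (x : face) : cone x (face_pt x).
Proof. exact: svalP (cid (face_nonempty x)). Qed.

Lemma face_ofP v (x : face) : cone x v <-> x = face_of v.
Proof.
split=> [/coneP h|->]; first exact: val_inj.
exact/coneP.
Qed.

Lemma face_eq (x y : face) : cone x = cone y -> x = y.
Proof.
move=> e; have := face_ptP x; rewrite {1}e => hy.
by rewrite ((face_ofP _ _).1 (face_ptP x)) ((face_ofP _ _).1 hy).
Qed.

Lemma scoordD v u a : scoord (v + u) a = scoord v a + scoord u a.
Proof. by rewrite /scoord mxE mulrDr. Qed.

Lemma scoordZ c v a : scoord (c *: v) a = c * scoord v a.
Proof. by rewrite /scoord mxE mulrCA. Qed.

Lemma scoordN v a : scoord v (sneg a) = - scoord v a.
Proof. by rewrite /scoord; case: a => i [] /=; rewrite ?expr0 ?expr1 ?mulN1r ?mul1r ?opprK. Qed.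

Lemma hformD h v u : hform h (v + u) = hform h v + hform h u.
Proof. by rewrite /hform !scoordD opprD addrACA. Qed.

Lemma hformZ h c v : hform h (c *: v) = c * hform h v.
Proof. by rewrite /hform !scoordZ mulrBr. Qed.

Definition smul (x y : signs) : signs :=
  [ffun h => if x h is Some b then Some b else y h].

Lemma sgn_perturb (a b : R) : a != 0 -> `|b| < `|a| -> sgn (a + b) = sgn a.
Proof.
move=> a0; rewrite /sgn (negbTE a0) => hb.
case: (ltgtP a 0) a0 hb => // ha _; [rewrite (ltr0_norm ha) | rewrite (gtr0_norm ha)];
  rewrite ltr_norml ?opprK => /andP[h1 h2].
  have lt0 : a + b < 0 by rewrite addrC -ltrBrDr sub0r.
  by rewrite lt_eqF // ltNge (ltW lt0).
have gt0 : 0 < a + b by rewrite addrC -ltrBlDr sub0r.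
by rewrite gt_eqF // gt0.
Qed.

Lemma smul_vsigns v u : exists2 e : R, 0 < e &
  forall t, 0 < t -> t <= e -> smul (vsigns v) (vsigns u) = vsigns (v + t *: u).
Proof.
pose F h := if hform h v == 0 then 1 else `|hform h v| / (`|hform h u| + 1).
have F0 h : 0 < F h.
  by rewrite /F; case: eqP => [//|/eqP h0]; rewrite divr_gt0 ?normr_gt0 ?ltr_wpDl.
exists (\big[Num.min/1]_h F h).
  by elim/big_ind: _ => // a b ha hb; rewrite lt_min ha hb.
move=> t t0 te; have {te} tF h : t <= F h.
  by apply: le_trans te _; rewrite (bigminD1 h) //= ge_min lexx.
apply/ffunP => h; rewrite !ffunE hformD hformZ.
case h0 : (hform h v == 0).
  by rewrite (eqP h0) add0r {1}/sgn eqxx /sgn mulf_eq0 (gt_eqF t0) pmulr_rgt0.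
rewrite sgn_perturb ?h0 //; first by rewrite /sgn h0.
rewrite normrM gtr0_norm //; have := tF h; rewrite /F h0 => le_t.
have p1 : 0 < `|hform h u| + 1 by rewrite ltr_wpDl.
apply: (@lt_le_trans _ _ (t * (`|hform h u| + 1))); first by rewrite ltr_pM2l // ltrDl.
by rewrite -ler_pdivlMr.
Qed.

Lemma smul_face (x y : face) : `[< (cone (smul x y) !=set0)%classic >].
Proof.
have [v hv] := face_nonempty x; have [u hu] := face_nonempty y.
have [e e0 he] := smul_vsigns v u.
apply/asboolP; exists (v + e *: u); apply/coneP.
by rewrite ((coneP _ _).1 hv) ((coneP _ _).1 hu) (he e).
Qed.

Definition face_mul (x y : face) : face := Face (smul_face x y).

Definition face_one : face := face_of 0.

Lemma face_mulA : associative face_mul.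
Proof.
move=> x y z; apply/val_inj/ffunP => h; rewrite /= !ffunE.
by case: (fsign x h).
Qed.

Lemma face_oneE h : fsign face_one h = None.
Proof. by rewrite /= ffunE /hform /scoord !mxE !mulr0 subrr /sgn eqxx. Qed.

Lemma face_mul1 : left_id face_one face_mul.
Proof. by move=> x; apply/val_inj/ffunP => h; rewrite ffunE face_oneE. Qed.

Lemma face_1mul : right_id face_one face_mul.
Proof.
by move=> x; apply/val_inj/ffunP => h; rewrite ffunE face_oneE; case: (fsign x h).
Qed.

HB.instance Definition _ := isMonoid.Build face face_mulA face_mul1 face_1mul.

(* w(x) is the face that contains w(v), where v is a
    point of x.  For w in D_n this is the image of x by w, see [cone_face_act]. *)
Definition face_act w (x : face) : face := face_of (vact w (face_pt x)).

Lemma scoord_vact w v a : signed_perm w -> scoord (vact w v) a = scoord v ((w^-1)%g a).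
Proof.
move=> /signed_permV/signed_permP hw; case: a => i b.
rewrite {1}/scoord mxE /=; case: b; rewrite ?expr0 ?mul1r //.
by rewrite expr1 mulN1r -scoordN -hw.
Qed.

Lemma scoord_same v u a b : vsigns v = vsigns u ->
  sgn (scoord v a - scoord v b) = sgn (scoord u a - scoord u b) \/
  a.1 = b.1.
Proof.
move=> e; pose P a b := sgn (scoord v a - scoord v b) = sgn (scoord u a - scoord u b).
have sgnN (x y : R) : sgn x = sgn y -> sgn (- x) = sgn (- y).
  by rewrite /sgn !oppr_eq0 !oppr_gt0; case: (ltgtP x 0); case: (ltgtP y 0).
have Pneg c d : P (sneg c) (sneg d) -> P c d.
  by move=> /sgnN; rewrite !scoordN !opprD !opprK.
have Psym c d : P c d -> P d c by move=> /sgnN; rewrite !opprB.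
have Plt (c d : sidx n) : (c.1 < d.1)%N -> P c d.
  have P0 (i : 'I_n) (d' : sidx n) : (i < d'.1)%N -> P (i, false) d'.
    by move=> lt; have /ffunP/(_ (Sub (i, d') lt)) := e; rewrite !ffunE.
  case: c => i [] lt; last exact: P0.
  by apply: Pneg; apply: P0.
by case: (ltngtP a.1 b.1) => [lt|lt|/ord_inj]; [left; apply: Plt|left; apply/Psym/Plt|right].
Qed.

Lemma vsigns_vact w v u : signed_perm w -> vsigns v = vsigns u ->
  vsigns (vact w v) = vsigns (vact w u).
Proof.
move=> hw e; apply/ffunP => h; rewrite !ffunE /hform !scoord_vact //.
have /signed_permP hV := signed_permV hw.
set a := (w^-1)%g _; set b := (w^-1)%g _.
case: (scoord_same a b e) => // eab; exfalso.
have ne1 : (val h).1 != (val h).2.1 by rewrite -val_eqE /= ltn_eqF // (valP h).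
have [] : a = b \/ a = sneg b.
  move: eab; case: a => i c; case: b => j d /= ->.
  by case: c; case: d; rewrite /sneg /=; [left|right|right|left].
- by move/perm_inj => e1; rewrite -e1 eqxx in ne1.
by rewrite -hV => /perm_inj => e1; move: ne1; rewrite -[(val h).2.1]/((sneg (val h).2).1) -e1 eqxx.
Qed.

Lemma vactK w : signed_perm w -> cancel (vact w) (vact w^-1%g).
Proof.
move=> hw v; apply/rowP => i; rewrite mxE scoord_vact // invgK permK.
by rewrite /scoord expr0 mul1r.
Qed.

Lemma cone_face_act w (x : face) : signed_perm w ->
  cone (face_act w x) = [set vact w v | v in cone x]%classic.
Proof.
move=> hw; apply/seteqP; split=> v.
  move=> /coneP hv; exists (vact w^-1%g v); last first.
    by rewrite -{1}(invgK w) vactK ?signed_permV.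
  apply/coneP; rewrite ((coneP _ _).1 (face_ptP x)).
  rewrite -{1}(vactK hw (face_pt x)); apply: vsigns_vact => //.
  exact: signed_permV.
case=> u /coneP hu <-; apply/coneP; rewrite /=; apply: vsigns_vact => //.
by rewrite -hu -((coneP _ _).1 (face_ptP x)).
Qed.

Lemma face_act_cone w (x : face) v : signed_perm w -> cone x v ->
  face_act w x = face_of (vact w v).
Proof. by move=> hw hv; apply/face_ofP; rewrite cone_face_act //; exists v. Qed.

Lemma face_act1 w : signed_perm w -> face_act w 1%g = 1%g.
Proof.
move=> hw; rewrite (@face_act_cone _ _ 0) //; last by apply/coneP.
by congr face_of; apply/rowP => i; rewrite !mxE /scoord mxE mulr0.
Qed.

Lemma vactD w v u : vact w (v + u) = vact w v + vact w u.
Proof. by apply/rowP => i; rewrite !mxE scoordD. Qed.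

Lemma vactZ w c v : vact w (c *: v) = c *: vact w v.
Proof. by apply/rowP => i; rewrite !mxE scoordZ. Qed.

Lemma face_actM w (x y : face) : signed_perm w ->
  face_act w (x * y)%g = (face_act w x * face_act w y)%g.
Proof.
move=> hw; have [v hv] := face_nonempty x; have [u hu] := face_nonempty y.
have [d d0 hd] := smul_vsigns v u.
have [e e0 he] := smul_vsigns (vact w v) (vact w u).
pose t := Num.min d e.
have t0 : 0 < t by rewrite lt_min d0 e0.
rewrite (face_act_cone hw hv) (face_act_cone hw hu).
rewrite (@face_act_cone _ _ (v + t *: u)) //; last first.
  by apply/coneP; rewrite /= ((coneP _ _).1 hv) ((coneP _ _).1 hu) (hd t) // ge_min lexx.
apply: val_inj; rewrite /= (he t) // ?ge_min ?lexx ?orbT //.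
by rewrite vactD vactZ.
Qed.

End Arrangement.

Section FaceAlgebra.

Variables (R : realFieldType) (k : fieldType) (n : nat).
Local Notation M := (face R n).

(* A function on faces stands for the formal combination of faces it lists. *)
Definition face_alg : Type := {ffun M -> k^o}.

HB.instance Definition _ := Vector.copy face_alg {ffun M -> k^o}.

Implicit Types (f g h : face_alg) (x y z : M).

Definition fbase x : face_alg := [ffun y => (x == y)%:R].

Definition falg_mul f g : face_alg :=
  \sum_x \sum_y (f x * g y : k) *: fbase (x * y)%g.

Lemma face_algE f : f = \sum_x (f x : k) *: fbase x.
Proof.
apply/ffunP => y; rewrite sum_ffunE (bigD1 y) //= big1 => [|x xy].
  by rewrite !ffunE eqxx addr0 /GRing.scale /= mulr1.
by rewrite !ffunE (negbTE xy) scaler0.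
Qed.

Lemma falg_mulDl : left_distributive falg_mul +%R.
Proof.
move=> f g h; rewrite -big_split; apply: eq_bigr => x _.
by rewrite -big_split; apply: eq_bigr => y _; rewrite ffunE mulrDl scalerDl.
Qed.

Lemma falg_mulDr : right_distributive falg_mul +%R.
Proof.
move=> f g h; rewrite -big_split; apply: eq_bigr => x _.
by rewrite -big_split; apply: eq_bigr => y _; rewrite ffunE mulrDr scalerDl.
Qed.

Lemma falg_scalerAl (c : k) f g : c *: falg_mul f g = falg_mul (c *: f) g.
Proof.
rewrite scaler_sumr; apply: eq_bigr => x _.
by rewrite scaler_sumr; apply: eq_bigr => y _; rewrite ffunE scalerA mulrA.
Qed.

Lemma falg_scalerAr (c : k) f g : c *: falg_mul f g = falg_mul f (c *: g).
Proof.
rewrite scaler_sumr; apply: eq_bigr => x _.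
rewrite scaler_sumr; apply: eq_bigr => y _.
by rewrite ffunE scalerA [_ *: g y]/(c * g y) mulrCA.
Qed.

Lemma falg_mul_base x y : falg_mul (fbase x) (fbase y) = fbase (x * y)%g.
Proof.
rewrite /falg_mul (bigD1 x) //= (bigD1 y) //= !ffunE !eqxx mulr1 scale1r.
rewrite big1 => [|z zy]; last by rewrite !ffunE eq_sym (negbTE zy) mulr0 scale0r.
rewrite addr0 big1 ?addr0 // => z zx; apply: big1 => t _.
by rewrite !ffunE eq_sym (negbTE zx) mul0r scale0r.
Qed.

Lemma falg_mul0l g : falg_mul 0 g = 0.
Proof. by rewrite -{1}(scale0r (0 : face_alg)) -falg_scalerAl scale0r. Qed.

Lemma falg_mul0r g : falg_mul g 0 = 0.
Proof. by rewrite -{1}(scale0r (0 : face_alg)) -falg_scalerAr scale0r. Qed.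

Lemma falg_mul_suml I (r : seq I) (P : pred I) (F : I -> face_alg) g :
  falg_mul (\sum_(i <- r | P i) F i) g = \sum_(i <- r | P i) falg_mul (F i) g.
Proof.
by apply: (big_morph (falg_mul^~ g) _ (falg_mul0l g)) => a b; apply: falg_mulDl.
Qed.

Lemma falg_mul_sumr I (r : seq I) (P : pred I) (F : I -> face_alg) g :
  falg_mul g (\sum_(i <- r | P i) F i) = \sum_(i <- r | P i) falg_mul g (F i).
Proof.
by apply: (big_morph (falg_mul g) _ (falg_mul0r g)) => a b; apply: falg_mulDr.
Qed.

Lemma falg_mulA : associative falg_mul.
Proof.
move: falg_mul_base falg_scalerAr falg_scalerAl falg_mul_sumr falg_mul_suml.
move: falg_mul => mul baseM sAr sAl sumr suml f g h.
rewrite (face_algE f) !suml; apply: eq_bigr => x _.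
rewrite -!sAl; congr (_ *: _).
rewrite (face_algE g) [in LHS]suml [in LHS]sumr.
rewrite [in RHS]sumr [in RHS]suml; apply: eq_bigr => y _.
rewrite -!(sAl, sAr); congr (_ *: _).
rewrite (face_algE h) !sumr; apply: eq_bigr => z _.
by rewrite -!sAr !baseM mulgA.
Qed.

Lemma falg_mul1 : left_id (fbase 1%g) falg_mul.
Proof.
move=> f; rewrite {1}(face_algE f) falg_mul_sumr [RHS]face_algE.
by apply: eq_bigr => x _; rewrite -falg_scalerAr falg_mul_base mul1g.
Qed.

Lemma falg_1mul : right_id (fbase 1%g) falg_mul.
Proof.
move=> f; rewrite {1}(face_algE f) falg_mul_suml [RHS]face_algE.
by apply: eq_bigr => x _; rewrite -falg_scalerAl falg_mul_base mulg1.
Qed.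

Lemma falg_one_neq0 : fbase 1%g != 0.
Proof.
by apply/eqP => /ffunP/(_ 1%g)/eqP; rewrite !ffunE eqxx oner_eq0.
Qed.

HB.instance Definition _ := GRing.Zmodule_isNzRing.Build face_alg
  falg_mulA falg_mul1 falg_1mul falg_mulDl falg_mulDr falg_one_neq0.
HB.instance Definition _ :=
  GRing.Lmodule_isLalgebra.Build k face_alg falg_scalerAl.
HB.instance Definition _ :=
  GRing.Lalgebra_isAlgebra.Build k face_alg falg_scalerAr.
HB.instance Definition _ := Algebra_isFalgebra.Build k face_alg.

Lemma fbase_mul x y : fbase x * fbase y = fbase (x * y)%g.
Proof. exact: falg_mul_base. Qed.

Lemma fbase_mulZ (c d : k) x y :
  (c *: fbase x) * (d *: fbase y) = c *: (d *: fbase (x * y)%g).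
Proof.
rewrite -[LHS]/(falg_mul _ _) -falg_scalerAl -falg_scalerAr.
by rewrite falg_mul_base.
Qed.

Lemma fbase1 : fbase 1%g = 1.
Proof. by []. Qed.

End FaceAlgebra.

Section Invariants.

Variables (R : realFieldType) (k : fieldType) (n : nat).

Local Notation face_alg := (face_alg R k n).
Local Notation fbase := (@fbase R k n).

Implicit Types (a b : face_alg) (w : {perm sidx n}).

(* The linear extension to kF of the action on F. *)
Definition alg_act w a : face_alg :=
  \sum_x (a x : k) *: fbase (face_act w x).

Lemma alg_act_is_linear w : linear (alg_act w).
Proof.
move=> c a b; rewrite scaler_sumr -big_split; apply: eq_bigr => x _.
by rewrite !ffunE scalerDl scalerA.
Qed.

HB.instance Definition _ w :=
  GRing.isLinear.Build k face_alg face_alg _ (alg_act w) (alg_act_is_linear w).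

Lemma alg_act_base w x : alg_act w (fbase x) = fbase (face_act w x).
Proof.
rewrite /alg_act (bigD1 x) //= ffunE eqxx scale1r big1 ?addr0 // => y yx.
by rewrite ffunE eq_sym (negbTE yx) scale0r.
Qed.

Lemma alg_act1 w : signed_perm w -> alg_act w 1 = 1.
Proof.
by move=> hw; rewrite -fbase1 alg_act_base face_act1.
Qed.

Lemma alg_actM w a b : signed_perm w -> alg_act w (a * b) = alg_act w a * alg_act w b.
Proof.
move=> hw; suff key (phi : {linear face_alg -> face_alg}) :
    (forall x, phi (fbase x) = fbase (face_act w x)) -> phi (a * b) = phi a * phi b.
  exact: (key (alg_act w) (alg_act_base w)).
move=> phiE.
rewrite (face_algE a) mulr_suml !linear_sum mulr_suml; apply: eq_bigr => x _.
rewrite (face_algE b) mulr_sumr !linear_sum mulr_sumr; apply: eq_bigr => y _.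
have Z c z : phi (c *: fbase z) = c *: fbase (face_act w z).
  by rewrite linearZ /= phiE.
have ZZ c d z : phi (c *: (d *: fbase z)) = c *: (d *: fbase (face_act w z)).
  by rewrite linearZ /= Z.
rewrite (Z (a x)) (Z (b y)) (@fbase_mulZ R k n (a x) (b y)) (ZZ (a x) (b y)).
by rewrite (@fbase_mulZ R k n (a x) (b y)) face_actM.
Qed.

Definition invariants : {vspace face_alg} :=
  (\bigcap_(w in Dgroup n) fixedSpace (linfun (alg_act w)))%VS.

Lemma invariantsP a :
  reflect (forall w, w \in Dgroup n -> alg_act w a = a) (a \in invariants).
Proof.
rewrite memvE; apply: (iffP subv_bigcapP) => h w /h.
  by rewrite -memvE => /fixedSpaceP; rewrite lfunE.
by move=> e; rewrite -memvE; apply/fixedSpaceP; rewrite lfunE.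
Qed.

Lemma invariants_aspace : is_aspace invariants.
Proof.
have sD w : w \in Dgroup n -> signed_perm w by rewrite inE => /andP[].
apply/andP; split.
  by apply/has_algid1/invariantsP => w /sD; apply: alg_act1.
apply/prodvP => a b /invariantsP ha /invariantsP hb; apply/invariantsP => w Dw.
by rewrite alg_actM ?sD // ha ?hb.
Qed.

Canonical invariant_alg : {aspace face_alg} := ASpace invariants_aspace.

End Invariants.

Section Radical.

Variables (k : fieldType) (A : falgType k).
Implicit Types (L : {vspace A}).

Definition left_ideal L : Prop := (fullv * L <= L)%VS.

Definition maximal_left_ideal L : Prop :=
  [/\ left_ideal L, L <> fullv &
      forall L', left_ideal L' -> (L <= L')%VS -> L' = L \/ L' = fullv].

Lemma vspace_of_submod (P : A -> Prop) : P 0 ->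
  (forall (c : k) a b, P a -> P b -> P (c *: a + b)) ->
  exists U : {vspace A}, forall a, a \in U <-> P a.
Proof.
move=> P0 Plin.
pose Q d := `[< exists2 U : {vspace A}, (forall a, a \in U -> P a) & \dim U = d >].
have Q0 : exists d, Q d.
  exists 0%N; apply/asboolP; exists 0%VS; last exact: dimv0.
  by move=> a; rewrite memv0 => /eqP->.
have Qle d : Q d -> (d <= \dim {:A})%N.
  by move=> /asboolP[U _ <-]; apply/dimvS/subvf.
case: (ex_maxnP Q0 Qle) => d /asboolP[U UP dU] dmax.
exists U => a; split=> [/UP//|Pa].
have hQ : Q (\dim (U + <[a]>)%VS).
  apply/asboolP; exists (U + <[a]>)%VS => // b /memv_addP[u uU [_ /vlineP[c ->] ->]].
  by rewrite addrC; apply: Plin => //; apply: UP.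
have := dmax _ hQ; rewrite -dU => hle.
have /eqP-> : U == (U + <[a]>)%VS by rewrite eqEdim addvSl.
by rewrite memvE addvSr.
Qed.

Lemma radical_exists : exists J : {vspace A},
  forall a, a \in J <-> forall L, maximal_left_ideal L -> a \in L.
Proof.
apply: vspace_of_submod => [L _|c a b ha hb L hL]; first exact: mem0v.
by rewrite memvD ?memvZ ?ha ?hb.
Qed.

(* The Jacobson radical: the intersection of the maximal left ideals, which in
   a finite dimensional algebra are subspaces. *)
Definition radical : {vspace A} := sval (cid radical_exists).

Lemma radicalP a :
  a \in radical <-> forall L, maximal_left_ideal L -> a \in L.
Proof. exact: (svalP (cid radical_exists)). Qed.

Definition idempotent (e : A) : Prop := e * e = e.

Definition primitive_idempotent (e : A) : Prop :=
  [/\ idempotent e, e <> 0 &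
      forall f g : A, idempotent f -> idempotent g -> f * g = 0 -> g * f = 0 ->
        e = f + g -> f = 0 \/ g = 0].

Definition complete_system (I : finType) (e : I -> A) : Prop :=
  [/\ forall v, primitive_idempotent (e v),
      forall v v', v != v' -> e v * e v' = 0 &
      \sum_v e v = 1].

(* The dimension of the image of U in the quotient space A / V. *)
Definition dim_mod (U V : {vspace A}) : nat := (\dim (U + V) - \dim V)%N.

End Radical.

(* A finite directed multigraph, given by the number of arrows x -> y. *)
Record quiver := Quiver { vertex : finType; narrows : vertex -> vertex -> nat }.

Definition arrow (Q : quiver) : Type :=
  {xy : vertex Q * vertex Q & 'I_(narrows xy.1 xy.2)}.

Definition source (Q : quiver) (a : arrow Q) : vertex Q := (tag a).1.
Definition target (Q : quiver) (a : arrow Q) : vertex Q := (tag a).2.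

(* A path is listed by its consecutive arrows, so that its length is [size p];
   the trivial paths are represented by the empty list. *)
Definition is_path (Q : quiver) (p : seq (arrow Q)) : bool :=
  sorted (fun a b : arrow Q => target a == source b) p.

(* The number of arrows x -> y is dim e_y (rad / rad^2) e_x, where
   e_y (rad / rad^2) e_x is the image of e_y rad e_x in rad / rad^2. *)
Definition alg_quiver (k : fieldType) (A : falgType k) (I : finType)
    (e : I -> A) : quiver :=
  @Quiver I (fun x y =>
    dim_mod (<[e y]> * radical A * <[e x]>)%VS (radical A * radical A)%VS).

(* Main.v *)
From HB Require Import structures.
Require Import Defs.
From mathcomp Require Import all_boot all_order all_algebra all_fingroup all_field.
From mathcomp Require Import all_solvable ring boolp.

(* Attach to a face [x] the flat [X] it spans.  The maps [chi_X], sending a face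
   [z] to 1 if [z] lies in [X] and to 0 otherwise, are characters of kF.  Since
   the characteristic does not divide the order of [W = D_n], orbit sums separate
   the W-orbits of flats, so each primitive idempotent [e_v] of (kF)^W is
   detected by the characters of a single orbit.

   Let [a = e_j r e_i <> 0] with [r] in the radical.  Let [Y] be a flat of least
   dimension carrying a nonzero coefficient of [a], let [a_Y] be the restriction
   of [a] to the faces spanning [Y], and let [x] be a face of largest dimension
   in [Y] with [x a_Y <> 0], spanning [X].  Then [chi_Y e_i = chi_X e_j = 1], and
   [X] is a proper subspace of [Y].

   The classes of the relation |v_i| = |v_j|, for [v] generic in a flat, are its
   blocks.  The potential of a flat is the number of nonzero blocks if it has a
   zero block with at least two elements, and otherwise 1 plus the number of odd
   blocks plus twice the number of even blocks.  If it does not drop by two from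
   [Y] to [X], then either a nonzero block [C] of [X] is the union of exactly two
   blocks of [Y], with [C] even or [Y] having a zero block, or one block [C] of
   [Y] is absorbed by an existing zero block.  In both cases negating [C],
   together with one coordinate that vanishes on [Y] when [C] is odd, is an
   element of [D_n]; relative to [x] it exchanges the two sides of a wall
   separating chambers of [Y].  The part of [x a_Y] on one side is opposite to
   the part on the other side by maximality of [x], and equal to it by
   invariance, so [2 x a_Y = 0], a contradiction.  The potential is at most
   [n + 1 = 2 m + 2], hence a path has at most [m + 1] arrows. *)

Set Implicit Arguments.
Unset Strict Implicit.
Unset Printing Implicit Defensive.

Import Order.TTheory GRing.Theory Num.Theory.

Local Open Scope ring_scope.

(** * Signs and flats of faces *)

Section Signs.
Variables (R : realFieldType) (n : nat).
Local Notation M := (face R n).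
Implicit Types (x y : M) (v : 'rV[R]_n) (p : sidx n * sidx n) (w : {perm sidx n}).

(* [None] also for the pairs (a, a) and (a, -a), which define no hyperplane. *)
Definition pair_sign v p : option bool :=
  if p.1.1 == p.2.1 then None else sgn (scoord v p.1 - scoord v p.2).

Definition sg x p : option bool := pair_sign (face_pt x) p.

(* Stands for the flat spanned by [x]; smaller flats have more zeros. *)
Definition zeros x : {set sidx n * sidx n} := [set p | sg x p == None].

Lemma pair_sign_same v u p : vsigns v = vsigns u -> pair_sign v p = pair_sign u p.
Proof.
move=> e; rewrite /pair_sign; case: eqP => // ne.
by case: (scoord_same p.1 p.2 e).
Qed.

Lemma vsigns_face_pt x : vsigns (face_pt x) = x.
Proof. by rewrite ((coneP _ _).1 (face_ptP x)). Qed.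

Lemma sg_face_of v p : sg (face_of v) p = pair_sign v p.
Proof. by apply: pair_sign_same; rewrite vsigns_face_pt. Qed.

Lemma sg_hyp x (h : hyp n) : sg x (((val h).1, false), (val h).2) = fsign x h.
Proof.
rewrite -vsigns_face_pt ffunE /sg /pair_sign /=.
by rewrite -val_eqE /= ltn_eqF // (valP h).
Qed.

Lemma sg_inj x y : (forall p, sg x p = sg y p) -> x = y.
Proof. by move=> e; apply/val_inj/ffunP => h; rewrite /= -!sg_hyp. Qed.

Lemma sgnN (c : R) : sgn (- c) = omap negb (sgn c).
Proof. by rewrite /sgn oppr_eq0 oppr_gt0; case: (ltgtP c 0). Qed.

Lemma sgnM_gt0 (l c : R) : 0 < l -> sgn (l * c) = sgn c.
Proof. by move=> l0; rewrite /sgn mulf_eq0 gt_eqF //= pmulr_rgt0. Qed.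

Lemma sgn_None (c : R) : (sgn c == None) = (c == 0).
Proof. by rewrite /sgn; case: (c == 0). Qed.

(** Negating both entries or swapping them brings any pair to the indexing of [hyp], up to a sign.
    As [h] and [b] do not depend on [x], the product rule passes from hyperplanes to all pairs. *)
Lemma sg_fsign p : p.1.1 != p.2.1 ->
  exists h b, forall x, sg x p = if b then omap negb (fsign x h) else fsign x h.
Proof.
pose Q p := exists h b, forall x,
  sg x p = if b then omap negb (fsign x h) else fsign x h.
have Qneg q : Q (sneg q.1, sneg q.2) -> Q q.
  case=> h [b e]; exists h, (~~ b) => x; move/(congr1 (omap negb)): (e x).
  rewrite /sg /pair_sign /=; case: eqP => _; last rewrite -sgnN !scoordN opprB addrC opprK.
    by case: b {e}; case: (fsign x h) => // -[].
  by move=> ->; case: b {e} => //; case: (fsign x h) => // -[].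
have Qsym q : Q (q.2, q.1) -> Q q.
  case=> h [b e]; exists h, (~~ b) => x; move/(congr1 (omap negb)): (e x).
  rewrite /sg /pair_sign /= eq_sym; case: eqP => _; last rewrite -sgnN opprB.
    by case: b {e}; case: (fsign x h) => // -[].
  by move=> ->; case: b {e} => //; case: (fsign x h) => // -[].
have Q0 (i : 'I_n) (a : sidx n) : (i < a.1)%N -> Q ((i, false), a).
  by move=> lt; exists (Sub (i, a) lt), false => x; rewrite -sg_hyp.
have Qlt (a b : sidx n) : (a.1 < b.1)%N -> Q (a, b).
  by case: a => i [] lt; [apply: Qneg|]; apply: Q0.
rewrite neq_ltn -/(Q p); case: p => a b /orP[] lt; first exact: Qlt.
by apply: Qsym; apply: Qlt.
Qed.

Lemma sg_diag x p : p.1.1 = p.2.1 -> sg x p = None.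
Proof. by rewrite /sg /pair_sign => ->; rewrite eqxx. Qed.

Lemma sg_mul x y p : sg (x * y)%g p = if sg x p is Some b then Some b else sg y p.
Proof.
case: (eqVneq p.1.1 p.2.1) => [e|/sg_fsign[h [b e]]]; first by rewrite !sg_diag.
by rewrite !e /= ffunE; case: (fsign x h); case: b {e}.
Qed.

Lemma zeros_mul x y : zeros (x * y)%g = zeros x :&: zeros y.
Proof. by apply/setP => p; rewrite !inE sg_mul; case: (sg x p). Qed.

Lemma face_mul_absorb x y : zeros x \subset zeros y -> (x * y)%g = x.
Proof.
move=> /subsetP s; apply: sg_inj => p; rewrite sg_mul.
case e: (sg x p) => [b|] //; apply/eqP.
by have := s p; rewrite !inE e; apply.
Qed.

Lemma vactM w w' v : signed_perm w -> signed_perm w' ->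
  vact w' (vact w v) = vact (w * w')%g v.
Proof.
by move=> hw hw'; apply/rowP => i; rewrite !mxE scoord_vact // invMg permM.
Qed.

Lemma face_actMg w w' x : signed_perm w -> signed_perm w' ->
  face_act w' (face_act w x) = face_act (w * w')%g x.
Proof.
move=> hw hw'; rewrite (@face_act_cone _ _ w' _ (vact w (face_pt x))) //.
  by rewrite vactM.
by apply/coneP.
Qed.

Lemma face_actK w : signed_perm w -> cancel (@face_act R n w) (face_act w^-1%g).
Proof.
move=> hw x; rewrite face_actMg ?signed_permV // mulgV.
rewrite /face_act [RHS](face_ofP (face_pt x) x).1; last exact: face_ptP.
by congr face_of; apply/rowP => i; rewrite mxE /scoord invg1 perm1 expr0 mul1r.
Qed.

Lemma sg_act w x p : signed_perm w ->
  sg (face_act w x) p = sg x ((w^-1)%g p.1, (w^-1)%g p.2).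
Proof.
move=> hw; rewrite /face_act sg_face_of /sg /pair_sign /= !scoord_vact //.
suff -> : (((w^-1)%g p.1).1 == ((w^-1)%g p.2).1) = (p.1.1 == p.2.1) by [].
have key u (a b : sidx n) : signed_perm u -> a.1 = b.1 -> (u a).1 = (u b).1.
  move=> /signed_permP hu; case: a b => i s [j t] /= ->.
  case: (eqVneq s t) => [->//|st]; have -> : (j, s) = sneg (j, t).
    by rewrite /sneg /=; case: s t st => [] [].
  by rewrite hu.
apply/eqP/eqP => e; last by apply: key => //; apply: signed_permV.
by rewrite -(permKV w p.1) -(permKV w p.2); apply: key.
Qed.

Lemma card_zeros_act w x : signed_perm w -> #|zeros (face_act w x)| = #|zeros x|.
Proof.
move=> hw; pose h (p : sidx n * sidx n) := ((w^-1)%g p.1, (w^-1)%g p.2).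
have hi : injective h by move=> [a b] [c d] [/perm_inj-> /perm_inj->].
have -> : zeros (face_act w x) = h @^-1: zeros x.
  by apply/setP => p; rewrite !inE sg_act.
rewrite on_card_preimset //; exists (fun p => (w p.1, w p.2)) => -[a b] _; rewrite /h /=.
  by rewrite !permKV.
by rewrite !permK.
Qed.

End Signs.

(** * Characters and layers of the face algebra *)

Section Characters.
Variables (R : realFieldType) (k : fieldType) (n : nat).
Local Notation M := (face R n).
Local Notation A := (face_alg R k n).
Local Notation fbase := (@fbase R k n).
Implicit Types (x y z c d g : M) (a f u : A) (S : {set sidx n * sidx n}).

Lemma falg_mulE f u z :
  (f * u) z = \sum_x \sum_y (f x : k) * u y * (x * y == z)%g%:R.
Proof.
rewrite -[f * u]/(falg_mul f u) /falg_mul sum_ffunE; apply: eq_bigr => x _.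
by rewrite sum_ffunE; apply: eq_bigr => y _; rewrite !ffunE.
Qed.

Definition chi S f : k := \sum_(x | S \subset zeros x) f x.

Lemma chi_linear S : scalar (chi S).
Proof.
move=> l f u; rewrite /chi mulr_sumr -big_split; apply: eq_bigr => x _.
by rewrite !ffunE.
Qed.

HB.instance Definition _ S := GRing.isLinear.Build k A k *%R (chi S) (chi_linear S).

Lemma chi_base S x : chi S (fbase x) = (S \subset zeros x)%:R.
Proof.
rewrite /chi; case: (boolP (S \subset zeros x)) => h.
  rewrite (bigD1 x) //= big1 ?addr0 ?ffunE ?eqxx // => y /andP[_ yx].
  by rewrite ffunE eq_sym (negbTE yx).
rewrite big1 // => y hy; rewrite ffunE; case: eqP => // e.
by rewrite e hy in h.
Qed.

(** A product of two faces lies in a flat exactly when both factors do, because [zeros] turns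
    products into intersections. *)
Lemma chiM S f u : chi S (f * u) = chi S f * chi S u.
Proof.
pose phi : {linear A -> k | *%R} := chi S.
have phib x : phi (fbase x) = (S \subset zeros x)%:R by apply: chi_base.
rewrite -[LHS]/(phi _) -[chi S f]/(phi f) -[chi S u]/(phi u).
rewrite {1}(face_algE f) {2}(face_algE f) mulr_suml !linear_sum mulr_suml.
apply: eq_bigr => x _.
rewrite {1}(face_algE u) {2}(face_algE u) mulr_sumr !linear_sum mulr_sumr.
apply: eq_bigr => y _.
rewrite (@fbase_mulZ R k n (f x) (u y)) !linearZ /= !phib zeros_mul subsetI -mulnb natrM.
by rewrite mulrACA mulrA.
Qed.

Lemma sub_zeros1 S : S \subset zeros (1%g : M).
Proof.
apply/subsetP => p _; rewrite inE sg_face_of /pair_sign; case: ifP => // _.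
by rewrite /scoord !mxE !mulr0 subrr /sgn eqxx.
Qed.

(* Right multiplication by a face that does not lie in the flat of [z] strictly
   raises the flat, so in top degree only the scalar [chi (zeros z) u] acts. *)
Lemma mul_top a u z : (forall x, a x != 0 -> (#|zeros x| <= #|zeros z|)%N) ->
  (a * u) z = a z * chi (zeros z) u.
Proof.
move=> top; rewrite falg_mulE (bigD1 z) //= [X in _ + X]big1 ?addr0 => [|x xz].
  rewrite /chi mulr_sumr [RHS]big_mkcond; apply: eq_bigr => y _.
  case: ifPn => h; first by rewrite face_mul_absorb // eqxx mulr1.
  case: eqP => [e|_]; last by rewrite mulr0.
  by rewrite -e zeros_mul subIset ?subxx ?orbT // in h; move: h; rewrite -{1}e zeros_mul subsetIr.
apply: big1 => y _; case: (eqVneq (x * y)%g z) => [e|_]; last by rewrite mulr0.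
case: (eqVneq (a x) 0) => [->|/top le]; first by rewrite !mul0r.
have s : zeros z \subset zeros x by rewrite -e zeros_mul subsetIl.
have ezx : zeros z = zeros x by apply/eqP; rewrite eqEcard s.
have : (x * y)%g = x by apply: face_mul_absorb; rewrite -ezx -e zeros_mul subsetIr.
by rewrite e => /esym/eqP; rewrite (negbTE xz).
Qed.

Lemma top_face a : a != 0 ->
  exists2 y, a y != 0 & forall x, a x != 0 -> (#|zeros x| <= #|zeros y|)%N.
Proof.
move=> a0; have [y0 hy0] : exists y, a y != 0.
  apply/existsP; apply: contraNT a0 => /existsPn h.
  by apply/eqP/ffunP => x; rewrite ffunE; apply/eqP; have := h x; rewrite negbK.
by case: (@arg_maxnP _ y0 (fun y => a y != 0) (fun y => #|zeros y|) hy0) => y; exists y.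
Qed.

Lemma chi_top a u y : a * u = a -> a y != 0 ->
  (forall x, a x != 0 -> (#|zeros x| <= #|zeros y|)%N) -> chi (zeros y) u = 1.
Proof.
move=> ag ay top; apply: (mulfI ay).
by rewrite -mul_top // ag mulr1.
Qed.

Definition layer S a : A := [ffun z => if zeros z == S then a z else 0].

Lemma layerE S a : layer S a = \sum_(z | zeros z == S) (a z : k) *: fbase z.
Proof.
rewrite [LHS]face_algE [RHS]big_mkcond; apply: eq_bigr => z _.
by rewrite ffunE; case: ifP => // _; rewrite scale0r.
Qed.

(** A product [t y] with zero set [S] needs both factors in the flat of [S], and [top] then forces
    [y] into the layer. So only the coefficients of [f] inside that flat act. *)
Lemma layer_fix f a S : f * a = a -> (forall x, a x != 0 -> (#|zeros x| <= #|S|)%N) ->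
  \sum_(t | S \subset zeros t) (f t : k) *: (fbase t * layer S a) = layer S a.
Proof.
move=> fa top; apply/ffunP => z; rewrite sum_ffunE.
have bE t : (fbase t * layer S a) z =
    \sum_y (layer S a y : k) * (t * y == z)%g%:R.
  rewrite falg_mulE (bigD1 t) //= [X in _ + X]big1 ?addr0.
    by apply: eq_bigr => y _; rewrite ffunE eqxx mul1r.
  by move=> x xt; apply: big1 => y _; rewrite ffunE eq_sym (negbTE xt) !mul0r.
rewrite ffunE; case: eqP => [zS|zS]; last first.
  apply: big1 => t tS; rewrite ffunE bE big1 ?scaler0 // => y _.
  rewrite ffunE; case: eqP => [yS|_]; last by rewrite mul0r.
  case: eqP => [e|_]; last by rewrite mulr0.
  by case: zS; rewrite -e zeros_mul yS; apply/setIidPr.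
rewrite -[in RHS]fa falg_mulE big_mkcond; apply: eq_bigr => t _.
case: ifPn => tS; last first.
  rewrite big1 // => y _; case: eqP => [e|_]; last by rewrite mulr0.
  by rewrite -zS -e zeros_mul subsetIl in tS.
rewrite ffunE bE /GRing.scale /= mulr_sumr; apply: eq_bigr => y _.
rewrite mulrA ffunE; case: eqP => // yS; rewrite mulr0 mul0r.
case: eqP => [e|_]; last by rewrite mulr0.
case: (eqVneq (a y) 0) => [->|/top le]; first by rewrite mulr0 mul0r.
case: yS; apply/eqP; rewrite eq_sym eqEcard le andbT -zS -e zeros_mul.
exact: subsetIr.
Qed.

(** Multiply [layer_fix] on the left by [x]. Faces [t] in the flat of [x] are absorbed and
    contribute [chi (zeros x) f] in total; for any other [t] the face [x t] has fewer zeros and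
    kills the layer by minimality. *)
Lemma layer_min f a S x : f * a = a -> (forall x, a x != 0 -> (#|zeros x| <= #|S|)%N) ->
  S \subset zeros x -> fbase x * layer S a != 0 ->
  (forall y, S \subset zeros y -> zeros y \proper zeros x -> fbase y * layer S a = 0) ->
  chi (zeros x) f = 1.
Proof.
move=> fa top Sx nz min; apply/eqP; rewrite -subr_eq0.
suff : (chi (zeros x) f - 1) *: (fbase x * layer S a) = 0.
  by move/eqP; rewrite scaler_eq0 (negbTE nz) orbF.
rewrite scalerBl scale1r; apply/eqP; rewrite subr_eq0; apply/eqP.
rewrite -[in RHS](layer_fix fa top) mulr_sumr /chi scaler_suml.
rewrite [in RHS](bigID (fun t => zeros x \subset zeros t)) /= [X in _ = _ + X]big1 ?addr0.
  rewrite big_mkcond [RHS]big_mkcond; apply: eq_bigr => t _.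
  case: (boolP (zeros x \subset zeros t)) => xt; rewrite ?andbF //.
  by rewrite (subset_trans Sx xt) /= -scalerAr mulrA fbase_mul face_mul_absorb.
move=> t /andP[St xt]; rewrite -scalerAr mulrA fbase_mul min ?scaler0 //.
  by rewrite zeros_mul subsetI Sx.
by rewrite zeros_mul properE subsetIl /= subsetI subxx.
Qed.

Lemma exists_layer_min a S : layer S a != 0 ->
  exists x, [/\ S \subset zeros x, fbase x * layer S a != 0 &
   forall y, S \subset zeros y -> zeros y \proper zeros x -> fbase y * layer S a = 0].
Proof.
move=> nz.
pose P x := (S \subset zeros x) && (fbase x * layer S a != 0).
have P1 : P 1%g by rewrite /P fbase1 mul1r nz sub_zeros1.
case: (@arg_minnP M (face_one R n) P (fun y => #|zeros y|) P1) => x /andP[Sx nx] min.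
exists x; split=> // y Sy /proper_card lt; apply/eqP; apply: contraTT lt => ny.
by rewrite -leqNgt min // /P Sy.
Qed.

(** A face spanning the flat of [S] absorbs every face of the layer on its right, so the product is
    [chi S a] times [fbase x]. *)
Lemma layer_sum0 a S x : chi S a = 0 -> (forall x, a x != 0 -> (#|zeros x| <= #|S|)%N) ->
  zeros x = S -> fbase x * layer S a = 0.
Proof.
move=> c0 top xS; rewrite layerE mulr_sumr.
rewrite (eq_bigr (fun z => (a z : k) *: fbase x)); last first.
  by move=> z /eqP zS; rewrite -scalerAr fbase_mul face_mul_absorb ?xS ?zS.
rewrite -scaler_suml; suff -> : \sum_(z | zeros z == S) (a z : k) = chi S a.
  by rewrite c0 scale0r.
rewrite /chi big_mkcond [RHS]big_mkcond; apply: eq_bigr => z _.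
case: eqP => [->|zS]; first by rewrite subxx.
case: ifP => // Sz; apply/esym/eqP; apply: contra_notT zS => /top le.
by apply/esym/eqP; rewrite eqEcard Sz le.
Qed.

Lemma invariant_coef a w z : a \in invariants R k n -> w \in Dgroup n ->
  a (face_act w z) = a z.
Proof.
move=> /invariantsP inv Dw; rewrite -{1}(inv w Dw) /alg_act sum_ffunE.
have sw : signed_perm w by move: Dw; rewrite inE => /andP[].
rewrite (bigD1 z) //= big1 ?addr0 => [|y yz].
  by rewrite !ffunE eqxx /GRing.scale /= mulr1.
rewrite !ffunE (inj_eq (can_inj (face_actK sw))) (negbTE yz).
by rewrite /GRing.scale /= mulr0.
Qed.

(* [w] exchanges the two sides [x * g] and [x * w g] of the flat of [x], so for
   every chamber [c] the pairs {x c, x (w c)} and {x g c, x (w g) (w c)} agree;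
   summing over the layer gives [2 (x * layer) = 0]. *)
Lemma flip_layer a S x g w : a \in invariants R k n -> w \in Dgroup n ->
  (2%:R : k) != 0 -> S \subset zeros x -> S \subset zeros g ->
  (forall c, S \subset zeros c -> forall p, p \in zeros x ->
     sg (face_act w c) p = if sg g p == None then sg c p else omap negb (sg c p)) ->
  (forall c, zeros c = S ->
     (forall p, p \in zeros x -> sg g p != None -> sg c p = sg g p) \/
     (forall p, p \in zeros x -> sg g p != None -> sg c p = omap negb (sg g p))) ->
  fbase (x * g)%g * layer S a = 0 -> fbase x * layer S a = 0.
Proof.
move=> inv Dw two Sx Sg hw hc xg0.
have sw : signed_perm w by move: Dw; rewrite inE => /andP[].
have sg0 c p : (p \in zeros c) = (sg c p == None) by rewrite inE.
have wS c : (zeros (face_act w c) == S) = (zeros c == S).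
  have imp c' : zeros c' = S -> zeros (face_act w c') = S.
    move=> cS; apply/esym/eqP; rewrite eqEcard card_zeros_act // cS leqnn andbT.
    apply/subsetP => p pS; rewrite sg0 hw ?cS ?(subsetP Sx) //.
    by move: (pS); rewrite -cS sg0 => /eqP->; case: ifP.
  apply/eqP/eqP => [e|]; last exact: imp.
  (* w^-1 is a power of w *)
  have iter_imp i c' : zeros c' = S -> zeros (iter i (face_act w) c') = S.
    by elim: i => //= i IH /IH/imp.
  have [i <-] : exists i, iter i (face_act w) (face_act w c) = c.
    exists (#[w]%g.-1); rewrite -iterSr prednK ?order_gt0 //.
    have powE j : iter j.+1 (face_act w) c = face_act (w ^+ j.+1)%g c.
      elim: j => [|j IH]; first by rewrite expg1.
      have sj : signed_perm (w ^+ j.+1)%g.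
        have : (w ^+ j.+1)%g \in Dgroup n by rewrite groupX.
        by rewrite inE => /andP[].
      by rewrite iterS IH face_actMg // -expgSr.
    rewrite -(prednK (order_gt0 w)) powE (prednK (order_gt0 w)) expg_order.
    apply: sg_inj => p; rewrite sg_act ?invg1 ?perm1; first by case: p.
    by apply/signed_permP => b; rewrite !perm1.
  exact: iter_imp.
have xw c : S \subset zeros c -> (x * face_act w (x * c) = x * face_act w c)%g.
  move=> Sc; rewrite face_actM // mulgA [(x * face_act w x)%g]face_mul_absorb //.
  apply/subsetP => p px; rewrite sg0 hw //.
  by move: px; rewrite sg0 => /eqP->; case: ifP.
have swap c : zeros c = S ->
    fbase (x * c)%g + fbase (x * face_act w c)%g =
    fbase (x * g * c)%g + fbase (x * face_act w (x * g * c))%g :> A.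
  move=> cS; have Sc : S \subset zeros c by rewrite cS.
  have Sgc : S \subset zeros (g * c)%g by rewrite zeros_mul subsetI Sg.
  rewrite -mulgA xw //.
  have eqx d d' : (forall p, p \in zeros x -> sg d p = sg d' p) -> (x * d = x * d')%g.
    move=> h; apply: sg_inj => p; rewrite !sg_mul; case e: (sg x p) => //.
    by apply: h; rewrite sg0 e.
  have wg p : p \in zeros x -> sg (face_act w (g * c)%g) p =
      if sg g p is Some b then Some (~~ b) else sg c p.
    by move=> px; rewrite hw // sg_mul; case: (sg g p).
  have wc p : p \in zeros x -> sg (face_act w c) p =
      if sg g p is Some b then omap negb (sg c p) else sg c p.
    by move=> px; rewrite hw //; case: (sg g p).
  (* If [c] is on the side of [g], the terms match in order; if it is on the opposite side, they
     match crosswise. *)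
  case: (hc c cS) => e.
    congr (fbase _ + fbase _); apply: eqx => p px.
      by rewrite sg_mul; case eg: (sg g p) => [b|] //; rewrite e ?eg.
    by rewrite wg // wc //; case eg: (sg g p) => [b|] //; rewrite e ?eg.
  rewrite addrC; congr (fbase _ + fbase _); apply: eqx => p px.
    rewrite sg_mul wc //; case eg: (sg g p) => [b|] //; rewrite e ?eg //=.
    by rewrite negbK.
  by rewrite wg //; case eg: (sg g p) => [b|] //; rewrite e ?eg.
have reindex (F : M -> A) : \sum_(c | zeros c == S) (a c : k) *: F c =
    \sum_(c | zeros c == S) (a c : k) *: F (face_act w c).
  rewrite (reindex_inj (can_inj (face_actK sw))) /=.
  by apply: eq_big => c; rewrite ?wS // invariant_coef.
have two_x : (2%:R : k) *: (fbase x * layer S a) = 0.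
  have mulE d : fbase d * layer S a = \sum_(c | zeros c == S) (a c : k) *: fbase (d * c)%g.
    by rewrite layerE mulr_sumr; apply: eq_bigr => c _; rewrite -scalerAr fbase_mul.
  rewrite -[2%:R]/(1 + 1) scalerDl scale1r {1}mulE mulE.
  rewrite [X in _ + X](reindex (fun c => fbase (x * c)%g)) -big_split /=.
  rewrite (eq_bigr (fun c => (a c : k) *: fbase (x * g * c)%g +
       (a c : k) *: fbase (x * face_act w (x * g * c))%g)); last first.
    by move=> c /eqP cS; rewrite -!scalerDr swap.
  rewrite big_split /= -mulE xg0 add0r.
  have -> : \sum_(c | zeros c == S) (a c : k) *: fbase (x * face_act w (x * g * c))%g =
      fbase x * alg_act w (fbase (x * g)%g * layer S a).
    pose phi : {linear A -> A} := alg_act w.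
    rewrite -[alg_act w _]/(phi _) mulE linear_sum mulr_sumr; apply: eq_bigr => c _.
    by rewrite linearZ -scalerAr /= alg_act_base fbase_mul.
  by rewrite xg0 (linear0 (alg_act w)) mulr0.
by apply/eqP; move/eqP: two_x; rewrite scaler_eq0 (negbTE two).
Qed.

End Characters.

(** * Counting the classes of a function *)

Section Classes.
Variables (T : finType) (V : eqType).
Implicit Types (f g : T -> V) (D C : {set T}) (W : {set T} -> nat).

Definition fclass f i : {set T} := [set j | f j == f i].
Definition fclasses f : {set {set T}} := [set fclass f i | i : T].

Lemma fclassP f i j : reflect (fclass f i = fclass f j) (f i == f j).
Proof.
apply: (iffP eqP) => [e|/setP/(_ i)]; first by apply/setP => l; rewrite !inE e.
by rewrite !inE eqxx => /esym/eqP.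
Qed.

Lemma fclasses_neq0 f D : D \in fclasses f -> (0 < #|D|)%N.
Proof. by case/imsetP => i _ ->; apply/card_gt0P; exists i; rewrite inE. Qed.

Lemma sum_card_fclasses f : (\sum_(D in fclasses f) #|D| = #|T|)%N.
Proof.
rewrite -sum1_card (partition_big (fclass f) [in fclasses f]) /=.
  apply: eq_bigr => _ /imsetP[i _ ->]; rewrite -sum1_card.
  by apply: eq_bigl => j; rewrite inE; apply/idP/eqP => /fclassP.
by move=> i _; apply: imset_f.
Qed.

Lemma card_fclass_sum f g i : (forall i j, f i = f j -> g i = g j) ->
  #|fclass g i| = (\sum_(D in fclasses f | D \subset fclass g i) #|D|)%N.
Proof.
move=> fg; rewrite -sum1_card.
rewrite (partition_big (fclass f) [pred D | (D \in fclasses f) && (D \subset fclass g i)]) /=.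
  apply: eq_bigr => _ /andP[/imsetP[j _ ->] /subsetP s]; rewrite -sum1_card.
  apply: eq_bigl => l; apply/andP/idP => [[_ /eqP/fclassP]|h]; first by rewrite inE.
  by split; [apply: s | apply/eqP/fclassP; rewrite inE in h].
move=> j; rewrite inE => /eqP ji; rewrite imset_f //=.
by apply/subsetP => l; rewrite !inE => /eqP/fg->; rewrite ji.
Qed.

Lemma sum_fclasses f g W : (forall i j, f i = f j -> g i = g j) ->
  (\sum_(D in fclasses f) W D =
   \sum_(C in fclasses g) \sum_(D in fclasses f | D \subset C) W D)%N.
Proof.
move=> fg.
(* [h] sends a class of [f] to the class of [g] that contains it. *)
pose h D := \bigcup_(i in D) fclass g i.
have hE i : h (fclass f i) = fclass g i.
  apply/setP => j; apply/bigcupP/idP => [[l]|ji]; last by exists i => //; rewrite inE.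
  by rewrite !inE => /eqP/fg->.
rewrite (partition_big h [in fclasses g]) /=.
  apply: eq_bigr => _ /imsetP[i _ ->]; apply: eq_bigl => D.
  case: (boolP (D \in fclasses f)) => //= /imsetP[j _ ->]; rewrite hE.
  apply/eqP/subsetP => [<- l|s].
    by rewrite !inE => /eqP/fg->.
  by apply/fclassP; have := s j; rewrite !inE eqxx; apply.
by move=> _ /imsetP[i _ ->]; rewrite hE imset_f.
Qed.

Lemma reindex_fclasses f g W (s : T -> T) : injective s ->
  (forall i j, (f i == f j) = (g (s i) == g (s j))) ->
  (forall D, W (s @: D) = W D) ->
  (\sum_(D in fclasses g) W D = \sum_(D in fclasses f) W D)%N.
Proof.
move=> si fg Ws; have [t ts st] : bijective s by apply: injF_bij.
have sc i : fclass g (s i) = s @: fclass f i.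
  apply/setP => j; rewrite -(st j) inE -fg mem_imset // inE.
  by [].
have -> : fclasses g = [set s @: D | D : {set T} in fclasses f].
  apply/setP => C; apply/imsetP/imsetP => [[i _ ->]|[_ /imsetP[i _ ->] ->]].
    by exists (fclass f (t i)); [apply: imset_f | rewrite -sc st].
  by exists (s i).
by rewrite big_imset /=; [apply: eq_bigr | apply: in2W; apply: imset_inj].
Qed.

Lemma sum_ge2 f C W i1 i2 : (forall j, f j = f i1 \/ f j = f i2 -> fclass f j \subset C) ->
  f i1 <> f i2 ->
  (W (fclass f i1) + W (fclass f i2) <= \sum_(D in fclasses f | D \subset C) W D)%N.
Proof.
move=> s ne; rewrite (bigD1 (fclass f i1)) /=; last by rewrite imset_f ?s //; left.
rewrite leq_add2l (bigD1 (fclass f i2)) /= ?leq_addr // imset_f // s /=; last by right.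
by apply/eqP => /esym/fclassP/eqP.
Qed.

Lemma sum_ge3 f C W i1 i2 i3 :
  (forall j, [\/ f j = f i1, f j = f i2 | f j = f i3] -> fclass f j \subset C) ->
  f i1 <> f i2 -> f i1 <> f i3 -> f i2 <> f i3 ->
  (W (fclass f i1) + W (fclass f i2) + W (fclass f i3) <=
   \sum_(D in fclasses f | D \subset C) W D)%N.
Proof.
move=> s n12 n13 n23; have n := fclassP f.
rewrite (bigD1 (fclass f i1)) /=; last by rewrite imset_f ?s //; constructor 1.
rewrite -addnA leq_add2l (bigD1 (fclass f i2)) /=; last first.
  rewrite imset_f ?s //=; last by constructor 2.
  by apply/eqP => /esym/fclassP/eqP.
rewrite leq_add2l (bigD1 (fclass f i3)) /= ?leq_addr // imset_f ?s //=; last by constructor 3.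
by apply/andP; split; apply/eqP => /esym/fclassP/eqP.
Qed.


Lemma sum_fclasses_le f g W1 W2 : (forall i j, f i = f j -> g i = g j) ->
  (forall i, W2 (fclass g i) <= \sum_(D in fclasses f | D \subset fclass g i) W1 D)%N ->
  (\sum_(C in fclasses g) W2 C <= \sum_(D in fclasses f) W1 D)%N.
Proof.
move=> fg le; rewrite (sum_fclasses W1 fg).
by apply: leq_sum => _ /imsetP[i _ ->].
Qed.

Lemma sum_fclasses_lt f g W1 W2 i1 : (forall i j, f i = f j -> g i = g j) ->
  (forall i, W2 (fclass g i) <= \sum_(D in fclasses f | D \subset fclass g i) W1 D)%N ->
  (W2 (fclass g i1) + 2 <= \sum_(D in fclasses f | D \subset fclass g i1) W1 D)%N ->
  (\sum_(C in fclasses g) W2 C + 2 <= \sum_(D in fclasses f) W1 D)%N.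
Proof.
move=> fg le lt; rewrite (sum_fclasses W1 fg) (bigD1 (fclass g i1)) ?imset_f //=.
rewrite [leqRHS](bigD1 (fclass g i1)) ?imset_f //= addnAC leq_add //.
by apply: leq_sum => _ /andP[/imsetP[i _ ->] _].
Qed.

Lemma fclass_sub f g i j : (forall i j, f i = f j -> g i = g j) -> g j = g i ->
  fclass f j \subset fclass g i.
Proof. by move=> fg ji; apply/subsetP => l; rewrite !inE => /eqP/fg->; rewrite ji. Qed.

Lemma sum_fclass_ge1 f g i W : (forall i j, f i = f j -> g i = g j) ->
  (W (fclass f i) <= \sum_(D in fclasses f | D \subset fclass g i) W D)%N.
Proof.
move=> fg; rewrite (bigD1 (fclass f i)) ?leq_addr // imset_f //=.
exact: fclass_sub.
Qed.

Lemma same_or_split f g : (forall i j, f i = f j -> g i = g j) ->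
  (forall i j, g i = g j -> f i = f j) \/ exists i1 i2, g i1 = g i2 /\ f i1 <> f i2.
Proof.
move=> fg; case: (boolP [forall i, forall j, (g i == g j) ==> (f i == f j)]) => [h|].
  by left=> i j e; have := forallP (forallP h i) j; rewrite e eqxx => /eqP.
move=> /forallPn[i1 /forallPn[i2]]; rewrite negb_imply => /andP[/eqP e /eqP ne].
by right; exists i1, i2.
Qed.

Lemma two_or_three f g i1 i2 :
  (forall j, g j = g i1 -> f j = f i1 \/ f j = f i2) \/
  exists j, [/\ g j = g i1, f i1 <> f j & f i2 <> f j].
Proof.
case: (boolP [forall j, (g j == g i1) ==> ((f j == f i1) || (f j == f i2))]) => [h|].
  left=> j e; have := forallP h j; rewrite e eqxx => /orP[]/eqP; [by left|by right].
move=> /forallPn[j]; rewrite negb_imply negb_or => /and3P[/eqP e /eqP n1 /eqP n2].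
by right; exists j; split=> // /esym.
Qed.

(** Take any class of [g] that splits: either it has exactly two pieces, or a third piece alone
    gives the drop by two. *)
Lemma card_fclasses_cases f g : (forall i j, f i = f j -> g i = g j) ->
  [\/ forall i j, g i = g j -> f i = f j,
      exists i1 i2, [/\ g i1 = g i2, f i1 <> f i2 &
                        forall j, g j = g i1 -> f j = f i1 \/ f j = f i2] |
      (#|fclasses g| + 2 <= #|fclasses f|)%N].
Proof.
move=> fg; case: (same_or_split fg) => [|[i1 [i2 [e ne]]]]; first by constructor 1.
case: (two_or_three f g i1 i2) => [h|[j [ej n1 n2]]].
  by constructor 2; exists i1, i2.
constructor 3; rewrite -!sum1_card; apply: (@sum_fclasses_lt f g (fun=> 1%N) (fun=> 1%N) i1) => //.
  by move=> i; apply: (@sum_fclass_ge1 f g i (fun=> 1%N)).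
apply: (@sum_ge3 f (fclass g i1) (fun=> 1%N) i1 i2 j) => // l h.
by apply: fclass_sub => //; case: h => /fg->.
Qed.

(* Parity of the weight equals parity of the size; this is what forbids a drop
   of one in [parity_cases]. *)
Definition parity_weight D : nat := (2 - odd #|D|)%N.

Lemma parity_weight_bounds D : (1 <= parity_weight D <= 2)%N.
Proof. by rewrite /parity_weight; case: odd. Qed.

Lemma odd_parity_weight D : odd (parity_weight D) = odd #|D|.
Proof. by rewrite /parity_weight; case: (odd #|D|). Qed.

Lemma parity_sum f g i : (forall i j, f i = f j -> g i = g j) ->
  odd (\sum_(D in fclasses f | D \subset fclass g i) parity_weight D)%N =
  odd #|fclass g i|.
Proof.
move=> fg; rewrite (card_fclass_sum i fg) !(big_morph odd oddD (erefl _)).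
by apply: eq_bigr => D _; rewrite odd_parity_weight.
Qed.

(** The right side is positive and has the parity of the class, so it is at least 2 when the class
    is even. *)
Lemma parity_fclass_le f g i : (forall i j, f i = f j -> g i = g j) ->
  (parity_weight (fclass g i) <=
     \sum_(D in fclasses f | D \subset fclass g i) parity_weight D)%N.
Proof.
move=> fg; have := parity_sum i fg.
have /andP[h _] := parity_weight_bounds (fclass f i).
have := leq_trans h (sum_fclass_ge1 i parity_weight fg).
set s := (\sum_(_ in _ | _) _)%N => s1 os.
rewrite /parity_weight -os; by case: s s1 {os} => [|[|s]] // _; case: odd.
Qed.

(** The pieces of a split class have total weight [s >= 2], of the same parity as the class. If
    [s = 2], the class is even with exactly two pieces; if [s = 3], it is odd and has weight 1; if
    [s >= 4], two are lost because a weight is at most 2. *)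
Lemma parity_cases f g : (forall i j, f i = f j -> g i = g j) ->
  [\/ forall i j, g i = g j -> f i = f j,
      exists i1 i2, [/\ g i1 = g i2, f i1 <> f i2,
                        forall j, g j = g i1 -> f j = f i1 \/ f j = f i2 &
                        ~~ odd #|fclass g i1|] |
      (\sum_(C in fclasses g) parity_weight C + 2 <=
         \sum_(D in fclasses f) parity_weight D)%N].
Proof.
move=> fg; case: (same_or_split fg) => [|[i1 [i2 [e ne]]]]; first by constructor 1.
have sub l : [\/ f l = f i1, f l = f i2 | g l = g i1] -> fclass f l \subset fclass g i1.
  by move=> h; apply: fclass_sub => //; case: h => [/fg->|/fg->|].
set s := (\sum_(D in fclasses f | D \subset fclass g i1) parity_weight D)%N.
have s2 : (2 <= s)%N.
  apply: leq_trans (@sum_ge2 f (fclass g i1) parity_weight i1 i2 _ ne); last first.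
    by move=> l [] h; apply: sub; [constructor 1 | constructor 2].
  rewrite -[2%N]/(1 + 1)%N leq_add //.
    by case/andP: (parity_weight_bounds (fclass f i1)).
  by case/andP: (parity_weight_bounds (fclass f i2)).
have os : odd s = odd #|fclass g i1| by apply: parity_sum.
have drop : (parity_weight (fclass g i1) + 2 <= s)%N ->
    (\sum_(C in fclasses g) parity_weight C + 2 <=
         \sum_(D in fclasses f) parity_weight D)%N.
  by apply: sum_fclasses_lt => // i; apply: parity_fclass_le.
case: (ltngtP s 3) => s3.
- have s_eq2 : s = 2%N by apply/eqP; rewrite eqn_leq s2 andbT.
  constructor 2; exists i1, i2; split=> //; last by rewrite -os s_eq2.
  case: (two_or_three f g i1 i2) => // -[j [ej n1 n2]]; exfalso.
  suff : (3 <= s)%N by rewrite s_eq2.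
  apply: leq_trans (@sum_ge3 f (fclass g i1) parity_weight i1 i2 j _ ne n1 n2); last first.
    by move=> l h; apply: sub; case: h => [||/fg->]; [constructor 1|constructor 2|constructor 3].
  rewrite -[3%N]/(1 + 1 + 1)%N !leq_add //.
  + by case/andP: (parity_weight_bounds (fclass f i1)).
  + by case/andP: (parity_weight_bounds (fclass f i2)).
  + by case/andP: (parity_weight_bounds (fclass f j)).
- constructor 3; apply: drop; apply: leq_trans s3.
  by rewrite -[4%N]/(2 + 2)%N leq_add2r; case/andP: (parity_weight_bounds (fclass g i1)).
- by constructor 3; apply: drop; rewrite s3 /parity_weight -os s3.
Qed.

Lemma parity_ge_card f : (#|fclasses f| <= \sum_(D in fclasses f) parity_weight D)%N.
Proof.
rewrite -sum1_card; apply: leq_sum => D _.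
by case/andP: (parity_weight_bounds D).
Qed.

(** Only a class with at least two elements can have weight 2. *)
Lemma parity_le_card f : (\sum_(D in fclasses f) parity_weight D <= #|T|)%N.
Proof.
rewrite -(sum_card_fclasses f); apply: leq_sum => D /fclasses_neq0.
by rewrite /parity_weight; case: #|D| => [//|[//|m]] _; case: odd.
Qed.

Lemma card_fclasses_le f g : (forall i j, f i = f j -> g i = g j) ->
  (#|fclasses g| <= #|fclasses f|)%N.
Proof.
move=> fg; rewrite -!sum1_card; apply: (@sum_fclasses_le f g (fun=> 1%N) (fun=> 1%N)) => // i.
exact: (@sum_fclass_ge1 f g i (fun=> 1%N)).
Qed.

End Classes.

(** * The potential *)

Section Potential.
Variables (R : realFieldType) (n : nat).
Implicit Types (v q u : 'rV[R]_n) (a b c : sidx n) (i j : 'I_n) (x y : face R n).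

Definition absc v i : R := `|v 0 i|.

(* A single zero coordinate is not detected by the hyperplanes of type D: it
   counts as an ordinary block of size one. *)
Definition two_zeros v : bool :=
  [exists i, exists j, [&& i != j, v 0 i == 0 & v 0 j == 0]].

(** The [- 1] discards the zero block, which is a class of [absc v] when coordinates vanish. The
    extra 1 in the other case makes the creation of a zero block cost two. *)
Definition phi v : nat :=
  if two_zeros v then (#|fclasses (absc v)| - 1)%N
  else (1 + \sum_(D in fclasses (absc v)) parity_weight D)%N.

Lemma two_zerosP v :
  reflect (exists i j, [/\ i != j, v 0 i = 0 & v 0 j = 0]) (two_zeros v).
Proof.
apply: (iffP existsP) => -[i].
  by case/existsP => j /and3P[ne /eqP vi /eqP vj]; exists i, j.
by case=> j [ne /eqP vi /eqP vj]; exists i; apply/existsP; exists j; apply/and3P.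
Qed.

Lemma norm_scoord v a : `|scoord v a| = absc v a.1.
Proof. by rewrite /scoord normrM normrX normrN1 expr1n mul1r. Qed.

Lemma eq_absc v a b : absc v a.1 = absc v b.1 ->
  scoord v a = scoord v b \/ scoord v a = scoord v (sneg b).
Proof. by rewrite -!norm_scoord scoordN => /eqP; rewrite eqr_norm2 => /orP[]/eqP; [left|right]. Qed.

Lemma scoord_eq_absc v a b : scoord v a = scoord v b -> absc v a.1 = absc v b.1.
Proof. by rewrite -!norm_scoord => ->. Qed.

Lemma scoord_eq0 v a : (scoord v a == 0) = (v 0 a.1 == 0).
Proof. by rewrite -normr_eq0 norm_scoord /absc normr_eq0. Qed.

Lemma pair_sign_None v a b :
  (pair_sign v (a, b) == None) = (a.1 == b.1) || (scoord v a == scoord v b).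
Proof. by rewrite /pair_sign /=; case: (a.1 == b.1) => //=; rewrite sgn_None subr_eq0. Qed.

Definition zerov v : {set sidx n * sidx n} := [set p | pair_sign v p == None].

Lemma in_zerov v a b :
  ((a, b) \in zerov v) = (a.1 == b.1) || (scoord v a == scoord v b).
Proof. by rewrite inE pair_sign_None. Qed.

Lemma zerosE x : zeros x = zerov (face_pt x).
Proof. by []. Qed.

Lemma zeros_face_of v : zeros (face_of v) = zerov v.
Proof. by apply/setP => p; rewrite !inE sg_face_of. Qed.

Lemma two_zeros_reindex v u (s : 'I_n -> 'I_n) : injective s ->
  (forall i, v 0 i == 0 -> u 0 (s i) == 0) -> two_zeros v -> two_zeros u.
Proof.
move=> si e /two_zerosP[i [j [ne /eqP/e/eqP hi /eqP/e/eqP hj]]]; apply/two_zerosP.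
by exists (s i), (s j); rewrite (inj_eq si).
Qed.

Lemma phi_vact (w : {perm sidx n}) v : signed_perm w -> phi (vact w v) = phi v.
Proof.
move=> hw; have /signed_permP hV := signed_permV hw.
(* The permutation of [n] underlying the inverse of [w]; blocks are transported along it. *)
pose s i := ((w^-1)%g (i, false)).1.
have si : injective s.
  move=> i j; rewrite /s => eij.
  have : (w^-1)%g (i, false) = (w^-1)%g (j, false) \/
    (w^-1)%g (i, false) = (w^-1)%g (sneg (j, false)).
    rewrite hV; move: eij; case: ((w^-1)%g (i, false)) => l c.
    case: ((w^-1)%g (j, false)) => l' d /= ->.
    by rewrite /sneg /=; case: c; case: d; [left|right|right|left].
  by case=> /perm_inj [].
have e i : absc (vact w v) i = absc v (s i) by rewrite {1}/absc mxE norm_scoord.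
have z : two_zeros (vact w v) = two_zeros v.
  have [t ts st] : bijective s by apply: injF_bij.
  have e0 i : (vact w v 0 i == 0) = (v 0 (s i) == 0).
    by rewrite -normr_eq0 -[`|_|]/(absc _ _) e normr_eq0.
  apply/idP/idP; first by apply: (two_zeros_reindex si) => i; rewrite e0.
  apply: (two_zeros_reindex (can_inj st)) => i; by rewrite e0 st.
have r (W : {set 'I_n} -> nat) : (forall D : {set 'I_n}, W (s @: D) = W D) ->
    (\sum_(D in fclasses (absc v)) W D = \sum_(D in fclasses (absc (vact w v))) W D)%N.
  by move=> Ws; apply: (reindex_fclasses si) => // i j; rewrite !e.
rewrite /phi z; case: ifP => _.
  by rewrite -!sum1_card (r (fun=> 1%N)).
by rewrite (r (@parity_weight _)) // => D; rewrite /parity_weight card_imset.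
Qed.

Lemma absc_zerov v u i j : zerov v \subset zerov u ->
  absc v i = absc v j -> absc u i = absc u j.
Proof.
move=> /subsetP s; case: (eqVneq i j) => [->//|ne] e.
have [h|h] := @eq_absc v (i, false) (j, false) e.
  have /s : ((i, false), (j, false)) \in zerov v by rewrite in_zerov h eqxx orbT.
  by rewrite in_zerov (negbTE ne) /= => /eqP/scoord_eq_absc.
have /s : ((i, false), sneg (j, false)) \in zerov v by rewrite in_zerov h eqxx orbT.
by rewrite in_zerov (negbTE ne) /= => /eqP/scoord_eq_absc.
Qed.

(** The equalities v_i = v_j and v_i = v_{-j} pass to [u] and force 2 u_j = 0. *)
Lemma zero_zerov v u i j : zerov v \subset zerov u -> i != j ->
  v 0 i = 0 -> v 0 j = 0 -> u 0 i = 0.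
Proof.
move=> /subsetP s ne i0 j0.
have z a : v 0 a.1 = 0 -> scoord v a = 0 by move=> h; apply/eqP; rewrite scoord_eq0 h.
have /s : ((i, false), (j, false)) \in zerov v by rewrite in_zerov !z // eqxx orbT.
have /s : ((i, false), (j, true)) \in zerov v by rewrite in_zerov !z // eqxx orbT.
rewrite !in_zerov (negbTE ne) /= => /eqP-> /eqP h.
have := scoordN u (j, false); rewrite /sneg /= h => /eqP.
rewrite -subr_eq0 opprK -mulr2n mulrn_eq0 /= scoord_eq0 /= => /eqP jj0.
by have := absc_zerov (introT subsetP s) (_ : absc _ i = absc _ j); rewrite /absc i0 j0 jj0 normr0 => /(_ erefl)/eqP; rewrite normr_eq0 => /eqP.
Qed.

Lemma two_zeros_sub v u : zerov v \subset zerov u ->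
  two_zeros v -> two_zeros u.
Proof.
move=> s /two_zerosP[i [j [ne i0 j0]]]; apply/two_zerosP; exists i, j; split=> //.
  exact: (zero_zerov s ne).
by apply: (zero_zerov s _ j0 i0); rewrite eq_sym.
Qed.

Lemma phi_zerov v u : zerov v = zerov u -> phi v = phi u.
Proof.
move=> e; have e1 : zerov v \subset zerov u by rewrite e.
have e2 : zerov u \subset zerov v by rewrite e.
have -> : phi v = if two_zeros u then (#|fclasses (absc v)| - 1)%N
  else (1 + \sum_(D in fclasses (absc v)) parity_weight D)%N.
  by rewrite /phi (_ : two_zeros v = two_zeros u) //; apply/idP/idP; apply: two_zeros_sub.
rewrite /phi (_ : fclasses (absc v) = fclasses (absc u)) //.
apply: eq_imset => i; apply/setP => j; rewrite !inE.
by apply/eqP/eqP; apply: absc_zerov.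
Qed.

Lemma phi_act (w : {perm sidx n}) x : signed_perm w ->
  phi (face_pt (face_act w x)) = phi (face_pt x).
Proof.
move=> hw; rewrite -[RHS](phi_vact _ hw); apply: phi_zerov.
exact: (zeros_face_of (vact w (face_pt x))).
Qed.

Lemma phi_le v : (phi v <= n + 1)%N.
Proof.
rewrite /phi addnC; case: ifP => _; last first.
  by rewrite leq_add2r -[n in (_ <= n)%N]card_ord; apply: parity_le_card.
apply: leq_trans (leq_subr _ _) _; apply: leq_trans (leq_addr _ _).
by apply: leq_trans (parity_ge_card _) _; rewrite -[n in (_ <= n)%N]card_ord; apply: parity_le_card.
Qed.

(** Once blocks and zero blocks agree, only signs inside a nonzero block could differ. But q_a = -
    q_b would pass to [v] by the inclusion, against v_a = v_b with v_a nonzero. *)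
Lemma zerov_sub v q : (forall i j, absc v i = absc v j -> absc q i = absc q j) ->
  (two_zeros v -> two_zeros q) -> zerov q \subset zerov v -> zerov v \subset zerov q.
Proof.
move=> e z s; apply/subsetP => -[a b]; rewrite !in_zerov.
case: (eqVneq a.1 b.1) => //= ab /eqP vab.
have qab := e _ _ (scoord_eq_absc vab).
case: (eqVneq (v 0 a.1) 0) => va.
  have vb : v 0 b.1 = 0 by apply/eqP; rewrite -scoord_eq0 -vab scoord_eq0 va.
  have /z : two_zeros v by apply/two_zerosP; exists a.1, b.1.
  case/two_zerosP => i [j [ij qi qj]]; have vi := zero_zerov s ij qi qj.
  have q0 c : v 0 c.1 = 0 -> scoord q c = 0.
    move=> vc; have := e c.1 i; rewrite /absc vc vi qi => /(_ erefl) h.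
    by apply/eqP; rewrite -normr_eq0 norm_scoord /absc h normr0.
  by rewrite !q0.
have [->//|h] := eq_absc qab.
have : (a, sneg b) \in zerov v by apply: (subsetP s); rewrite in_zerov h eqxx orbT.
rewrite in_zerov (negbTE ab) /= scoordN -vab -subr_eq0 opprK -mulr2n mulrn_eq0 /=.
by rewrite scoord_eq0 (negbTE va).
Qed.

(** The cases are whether [q], only [v], or neither has two zeros. The first compares numbers of
    blocks, the last compares parity weights, and in the middle one the drop is automatic. *)
Lemma phi_drop v q : zerov q \proper zerov v ->
  [\/ (phi v + 2 <= phi q)%N,
      exists i1 i2, [/\ v 0 i1 != 0, absc v i1 = absc v i2, absc q i1 <> absc q i2,
        forall j, absc v j = absc v i1 -> absc q j = absc q i1 \/ absc q j = absc q i2 &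
        ~~ odd #|fclass (absc v) i1| \/ two_zeros q] |
      exists i, [/\ two_zeros q, q 0 i != 0, v 0 i = 0 &
        forall j, v 0 j = 0 -> q 0 j = 0 \/ absc q j = absc q i]].
Proof.
move=> /andP[s ns].
have fg i j : absc q i = absc q j -> absc v i = absc v j by apply: absc_zerov.
have absc0 u i j : u 0 i = 0 -> (absc u j = absc u i) <-> (u 0 j = 0).
  rewrite /absc => ->; rewrite normr0; split=> [/eqP|->]; rewrite ?normr0 //.
  by rewrite normr_eq0 => /eqP.
case: (boolP (two_zeros q)) => [zq|nq].
  have zv := two_zeros_sub s zq.
  rewrite /phi zq zv; case: (card_fclasses_cases fg).
  - by move=> e; case/negP: ns; apply: zerov_sub.
  - move=> [i1 [i2 [e ne h]]]; case: (eqVneq (v 0 i1) 0) => v1; last first.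
      by constructor 2; exists i1, i2; split=> //; right.
    (* The merged class is the zero block of [v]: one of its two pieces is the zero block of [q],
       the other is the absorbed block. *)
    constructor 3; case/two_zerosP: (zq) => z [z' [nz qz qz']].
    have vz := zero_zerov s nz qz qz'.
    have : absc q z = absc q i1 \/ absc q z = absc q i2 by apply: h; rewrite /absc v1 vz.
    have v2 : v 0 i2 = 0 by apply/(absc0 v i1 i2 v1).
    case=> hz; [have q1 : q 0 i1 = 0 by apply/(absc0 q z i1 qz) | have q2 : q 0 i2 = 0 by apply/(absc0 q z i2 qz)].
      exists i2; split=> //; first by apply/eqP => /(absc0 q i1 i2 q1) /esym.
      by move=> j /(absc0 v i1 j v1)/h[/(absc0 q i1 j q1)|]; [left|right].
    exists i1; split=> //; first by apply/eqP => /(absc0 q i2 i1 q2).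
    by move=> j /(absc0 v i1 j v1)/h[|/(absc0 q i2 j q2)]; [right|left].
  - move=> h; constructor 1.
    have := card_fclasses_le fg; have [z _] := two_zerosP _ zv.
    have : (0 < #|fclasses (absc v)|)%N by apply/card_gt0P; exists (fclass (absc v) z); apply: imset_f.
    by move: h; case: #|fclasses (absc v)| => [//|a]; case: #|fclasses (absc q)| => [//|b]; rewrite !subSS !subn0 addSn ltnS.
case: (boolP (two_zeros v)) => zv.
  constructor 1; rewrite /phi zv (negbTE nq).
  have h := leq_trans (card_fclasses_le fg) (parity_ge_card (absc q)).
  have [z _] := two_zerosP _ zv.
  have : (0 < #|fclasses (absc v)|)%N by apply/card_gt0P; exists (fclass (absc v) z); apply: imset_f.
  by move: h; case: #|fclasses (absc v)| => [//|a] h _; rewrite subSS subn0 addn2 add1n ltnS.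
case: (parity_cases fg).
- by move=> e; case/negP: ns; apply: zerov_sub => //; rewrite (negbTE zv).
- move=> [i1 [i2 [e ne h ev]]]; constructor 2; exists i1, i2; split=> //; last by left.
  apply: contraNneq zv => v1; apply/two_zerosP; exists i1, i2; split=> //.
    by apply/eqP => i12; case: ne; rewrite i12.
  by apply/(absc0 v i1 i2 v1).
- by move=> h; constructor 1; rewrite /phi (negbTE zv) (negbTE nq) -addnA leq_add2l.
Qed.

End Potential.

(** * Sign changes in type D *)

Section SignChange.
Variable n : nat.
Implicit Types (N : {set 'I_n}) (a : sidx n).

Definition flip N a : sidx n := (a.1, a.2 (+) (a.1 \in N)).

Lemma flipK N : involutive (flip N).
Proof. by case=> i s; rewrite /flip /= addbK. Qed.

Definition neg_perm N : {perm sidx n} := perm (inv_inj (flipK N)).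

Lemma neg_permE N a : neg_perm N a = flip N a.
Proof. exact: permE. Qed.

Lemma neg_permV N : (neg_perm N)^-1%g = neg_perm N.
Proof.
apply/permP => a; apply: (@perm_inj _ (neg_perm N)).
by rewrite permKV !neg_permE flipK.
Qed.

Lemma signed_neg_perm N : signed_perm (neg_perm N).
Proof.
apply/signed_permP => a; rewrite !neg_permE /flip /sneg /=.
by case: (a.2); case: (a.1 \in N).
Qed.

Lemma neg_perm_D N : ~~ odd #|N| -> neg_perm N \in Dgroup n.
Proof.
move=> ev; rewrite inE signed_neg_perm /= (_ : negated _ = N) //.
by apply/setP => i; rewrite inE neg_permE.
Qed.

Lemma scoord_neg (R : realFieldType) N (v : 'rV[R]_n) a :
  scoord (vact (neg_perm N) v) a = (-1) ^+ (a.1 \in N) * scoord v a.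
Proof.
rewrite scoord_vact ?signed_neg_perm // neg_permV neg_permE /scoord /flip /=.
by rewrite signr_addb mulrAC mulrC mulrA.
Qed.

End SignChange.

(** * Vanishing of minimal products when the potential does not drop by two *)

Section Drop.
Variables (R : realFieldType) (k : fieldType) (n : nat).
Local Notation A := (face_alg R k n).
Local Notation fbase := (@fbase R k n).
Local Notation pt := (@face_pt R n).
Implicit Types (x y d : face R n) (a f u : A) (b c : sidx n) (v q t : 'rV[R]_n).
Implicit Types (N : {set 'I_n}) (w : {perm sidx n}).

(* [t] is a direction inside the flat of [y] that leaves the flat of [x] and that
   [w] reverses modulo the flat of [x]. *)
Lemma flip_vector a x y t w b0 c0 :
  a \in invariants R k n -> w \in Dgroup n -> (2%:R : k) != 0 ->
  zeros y \subset zeros x ->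
  (forall b c, (b, c) \in zeros y -> b.1 != c.1 -> scoord t b = scoord t c) ->
  (b0, c0) \in zeros x -> b0.1 != c0.1 -> scoord t b0 != scoord t c0 ->
  (forall d, zeros y \subset zeros d -> exists l, forall b c,
     (b, c) \in zeros x -> b.1 != c.1 ->
     if scoord t b == scoord t c then
       scoord (vact w (pt d)) b - scoord (vact w (pt d)) c =
       scoord (pt d) b - scoord (pt d) c
     else
       scoord (pt d) b - scoord (pt d) c = l * (scoord t b - scoord t c) /\
       scoord (vact w (pt d)) b - scoord (vact w (pt d)) c =
       - (scoord (pt d) b - scoord (pt d) c)) ->
  (forall z, zeros y \subset zeros z -> zeros z \proper zeros x ->
     fbase z * layer (zeros y) a = 0) ->
  fbase x * layer (zeros y) a = 0.
Proof.
move=> inv Dw two yx ty xp0 ne0 t0 key min.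
have gp p : sg (face_of t) p = pair_sign t p by rewrite sg_face_of.
have yt : zeros y \subset zeros (face_of t).
  apply/subsetP => -[b c] yp; rewrite inE gp pair_sign_None.
  by case: (eqVneq b.1 c.1) => //= ne; rewrite (ty _ _ yp ne).
apply: (@flip_layer R k n a _ x (face_of t) w) => //.
- move=> d yd [b c] xp; have [l h] := key d yd.
  case: (eqVneq b.1 c.1) => [e|ne].
    by rewrite !(@sg_diag _ _ _ (b, c)) //; case: ifP.
  have {h} := h b c xp ne; rewrite gp pair_sign_None (negbTE ne) /=.
  rewrite /face_act sg_face_of /sg /pair_sign /= (negbTE ne).
  by case: ifP => _; [move=> -> | case=> _ ->; rewrite sgnN].
- move=> d dy; have [|l h] := key d; first by rewrite dy.
  (* If [l = 0], then [d], which spans the flat of [y], has equal values at [b0] and [c0]; so would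
     [t], by [ty]. *)
  have l0 : l != 0.
    apply/eqP => l0; have := h _ _ xp0 ne0; rewrite (negbTE t0) => -[e _].
    case/negP: t0; rewrite (ty _ _ _ ne0) // -dy in_zerov (negbTE ne0) /=.
    by rewrite -subr_eq0 e l0 mul0r.
  have key2 p : p \in zeros x -> sg (face_of t) p != None ->
      sg d p = sgn (l * (scoord t p.1 - scoord t p.2)) /\
      sg (face_of t) p = sgn (scoord t p.1 - scoord t p.2).
    case: p => b c xp; rewrite gp pair_sign_None negb_or => /andP[ne tne].
    have := h _ _ xp ne; rewrite (negbTE tne) => -[e _].
    by rewrite /sg /pair_sign (negbTE ne) /= e.
  case: (ltgtP l 0) l0 => // hl _; [right|left] => p xp /(key2 p xp)[-> ->].
    by rewrite -sgnN -[RHS](@sgnM_gt0 _ (- l)) ?oppr_gt0 // mulrNN.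
  by rewrite sgnM_gt0.
- apply: min; rewrite zeros_mul; first by rewrite subsetI yx.
  rewrite properE subsetIl /= subsetI subxx /=; apply/subsetPn; exists (b0, c0) => //.
  by rewrite inE gp pair_sign_None negb_or ne0.
Qed.

(** If [N] has odd size, negating one more coordinate [i] restores evenness. As [y] has two zeros,
    [i] vanishes on its whole flat, so the extra sign is invisible there; the second hypothesis
    keeps [i] out of [N]. *)
Lemma exists_sign_change y N : ~~ odd #|N| \/ two_zeros (pt y) ->
  (forall i j, i != j -> pt y 0 i = 0 -> pt y 0 j = 0 -> i \notin N) ->
  exists2 w, w \in Dgroup n & forall d, zeros y \subset zeros d -> forall b,
    scoord (vact w (pt d)) b = (-1) ^+ (b.1 \in N) * scoord (pt d) b.
Proof.
move=> h zN; case: (boolP (odd #|N|)) h => [odN|evN] h; last first.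
  by exists (neg_perm N); [apply: neg_perm_D | move=> d _ b; rewrite scoord_neg].
case: h => // /two_zerosP[i [j [ij yi yj]]].
exists (neg_perm (i |: N)) => [|d yd b].
  by apply: neg_perm_D; rewrite cardsU1 (zN i j ij yi yj) /= odN.
rewrite scoord_neg in_setU1; case: eqP => [bi|//] /=.
have -> : scoord (pt d) b = 0.
  by apply/eqP; rewrite scoord_eq0 bi (zero_zerov yd ij yi yj).
by rewrite !mulr0.
Qed.

(** A nonzero coordinate of [x] fixes the relative sign: with the opposite sign on [y], [x] would
    satisfy both equations and vanish there. *)
Lemma eq_scoord_sub x y b c : zeros y \subset zeros x ->
  scoord (pt x) b = scoord (pt x) c -> pt x 0 b.1 != 0 -> b.1 != c.1 ->
  absc (pt y) b.1 = absc (pt y) c.1 -> (b, c) \in zeros y.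
Proof.
move=> yx xbc x0 ne /eq_absc[h|h]; first by rewrite in_zerov h eqxx orbT.
have /(subsetP yx) : (b, sneg c) \in zeros y by rewrite in_zerov h eqxx orbT.
rewrite in_zerov (negbTE ne) /= scoordN -xbc -subr_eq0 opprK -mulr2n mulrn_eq0 /=.
by rewrite scoord_eq0 (negbTE x0).
Qed.

Lemma scoord_row (P : pred 'I_n) v b :
  scoord (\row_j if P j then v 0 j else 0) b = if P b.1 then scoord v b else 0.
Proof. by rewrite /scoord mxE; case: ifP; rewrite ?mulr0. Qed.

Lemma scoord_col v i s : scoord v (i, s) = (-1) ^+ s * v 0 i.
Proof. by []. Qed.

(** Any [d] in the flat of [y] is [l1 x] on the piece [B] of the block [C] and [l2 x] on the rest of
    [C]. Modulo the flat of [x], only [l1 - l2] is visible on [C], and negating [C] reverses it. *)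
Lemma split_zero a x y i1 i2 : a \in invariants R k n -> (2%:R : k) != 0 ->
  zeros y \subset zeros x -> pt x 0 i1 != 0 ->
  absc (pt x) i1 = absc (pt x) i2 -> absc (pt y) i1 <> absc (pt y) i2 ->
  (forall j, absc (pt x) j = absc (pt x) i1 ->
     absc (pt y) j = absc (pt y) i1 \/ absc (pt y) j = absc (pt y) i2) ->
  ~~ odd #|fclass (absc (pt x)) i1| \/ two_zeros (pt y) ->
  (forall z, zeros y \subset zeros z -> zeros z \proper zeros x ->
     fbase z * layer (zeros y) a = 0) ->
  fbase x * layer (zeros y) a = 0.
Proof.
move=> inv two yx x1 x12 y12 two_classes par min.
pose C := fclass (absc (pt x)) i1; pose B j := absc (pt y) j == absc (pt y) i1.
have inC j : (j \in C) = (absc (pt x) j == absc (pt x) i1) by rewrite inE.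
have xC j : j \in C -> pt x 0 j != 0.
  by rewrite inC => /eqP e; rewrite -normr_eq0 -[`|_|]/(absc _ _) e normr_eq0.
have BC j : B j -> j \in C by rewrite inC => /eqP/(absc_zerov yx)->.
have [|w Dw wE] := @exists_sign_change y C par.
  move=> i j ij yi yj; apply/negP => /xC; rewrite (zero_zerov yx ij yi yj).
  by rewrite eqxx.
(* A direction inside the flat of [y] that pulls the two pieces of [C] apart. *)
pose t : 'rV[R]_n := \row_j if B j then pt x 0 j else 0.
have tE b : scoord t b = if B b.1 then scoord (pt x) b else 0 by apply: scoord_row.
(* points of the flat of y are proportional to x on each of the two classes *)
have prop d b c : zeros y \subset zeros d -> b.1 \in C -> absc (pt y) b.1 = absc (pt y) c.1 ->
    scoord (pt d) b * scoord (pt x) c = scoord (pt d) c * scoord (pt x) b.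
  move=> yd bC ybc; have xbc := absc_zerov yx ybc.
  case: (eqVneq b.1 c.1) => [e|ne].
    by rewrite /scoord e; ring.
  have aux b' c' : b'.1 = b.1 -> c'.1 = c.1 -> scoord (pt x) b' = scoord (pt x) c' ->
      scoord (pt d) b' = scoord (pt d) c'.
    move=> eb ec e; have /(subsetP yd) : (b', c') \in zeros y.
      by apply: (eq_scoord_sub yx) => //; rewrite ?eb ?ec ?xC.
    by rewrite in_zerov eb ec (negbTE ne) /= => /eqP.
  case: (eq_absc xbc) => e; first by rewrite (aux b c) // e.
  by have := aux b (sneg c) erefl erefl e; rewrite e !scoordN => ->; rewrite mulrN mulNr.
have x2 : pt x 0 i2 != 0 by apply: xC; rewrite inC x12.
have C1 : i1 \in C by rewrite inC.
have C2 : i2 \in C by rewrite inC x12.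
have nB2 : ~~ B i2 by apply/eqP => /esym.
have [b0 [c0 [b1 c2 e0]]] : exists b0 c0 : sidx n, [/\ b0.1 = i1, c0.1 = i2 &
    scoord (pt x) b0 = scoord (pt x) c0].
  have [e|e] := @eq_absc _ _ (pt x) (i1, false) (i2, false) x12.
    by exists (i1, false), (i2, false).
  by exists (i1, false), (sneg (i2, false)).
have ne12 : i1 != i2 by apply/eqP => e; case: y12; rewrite e.
apply: (@flip_vector a x y t w b0 c0) => //.
- move=> b c yp ne; rewrite !tE /B.
  have := yp; rewrite in_zerov (negbTE ne) /= => /eqP/scoord_eq_absc->; case: ifP => // _.
  by have /(subsetP yx) := yp; rewrite in_zerov (negbTE ne) => /eqP.
- by rewrite in_zerov e0 eqxx orbT.
- by rewrite b1 c2.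
- by rewrite !tE b1 c2 /B eqxx -/(B i2) (negbTE nB2) scoord_eq0 b1.
move=> d yd.
pose l1 := pt d 0 i1 / pt x 0 i1; pose l2 := pt d 0 i2 / pt x 0 i2.
have dB b : B b.1 -> scoord (pt d) b = l1 * scoord (pt x) b.
  move=> Bb; have := prop d b (i1, false) yd (BC _ Bb) (eqP Bb).
  rewrite !scoord_col !expr0 !mul1r => h; apply: (mulIf x1); rewrite h /l1.
  by field.
have dB' b : b.1 \in C -> ~~ B b.1 -> scoord (pt d) b = l2 * scoord (pt x) b.
  move=> bC nB; have : absc (pt y) b.1 = absc (pt y) i2.
    by case: (two_classes b.1) => //; [apply/eqP; rewrite -inC | move/eqP; rewrite -/(B _) (negbTE nB)].
  move=> e; have := prop d b (i2, false) yd bC e.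
  rewrite !scoord_col !expr0 !mul1r => h; apply: (mulIf x2); rewrite h /l2.
  by field.
(* For [b] in [B] and [c] in the other piece, d_b - d_c = (l1 - l2) x_b, while t_b = x_b and t_c =
   0. *)
exists (l1 - l2) => b c xp ne; rewrite !wE // !tE.
move: (xp); rewrite in_zerov (negbTE ne) /= => /eqP xbc.
have bcC : (c.1 \in C) = (b.1 \in C) by rewrite !inC (scoord_eq_absc xbc).
rewrite bcC; case: (boolP (b.1 \in C)) => bC; last first.
  have nB e : e.1 \notin C -> B e.1 = false by move=> h; apply/negbTE; apply: contra h; apply: BC.
  by rewrite !nB ?bcC // eqxx !expr0 !mul1r.
have cC : c.1 \in C by rewrite bcC.
have x0 : scoord (pt x) b != 0 by rewrite scoord_eq0 xC.
rewrite !expr1 !mulN1r.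
case: (boolP (B b.1)) => Bb; case: (boolP (B c.1)) => Bc.
- by rewrite xbc eqxx !dB // xbc !subrr.
- rewrite (negbTE x0) (dB b) // (dB' c) // -xbc; split; ring.
- by rewrite -xbc eq_sym (negbTE x0) (dB' b) // (dB c) // -xbc; split; ring.
- by rewrite eqxx !dB' // xbc !subrr.
Qed.

(** Same scheme as [split_zero], but [x] vanishes on the absorbed block, so [t] is cut out of [y]
    instead, and the zero block of [y] serves as the other piece. *)
Lemma absorb_zero a x y i1 : a \in invariants R k n -> (2%:R : k) != 0 ->
  zeros y \subset zeros x -> two_zeros (pt y) -> pt y 0 i1 != 0 -> pt x 0 i1 = 0 ->
  (forall j, pt x 0 j = 0 -> pt y 0 j = 0 \/ absc (pt y) j = absc (pt y) i1) ->
  (forall z, zeros y \subset zeros z -> zeros z \proper zeros x ->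
     fbase z * layer (zeros y) a = 0) ->
  fbase x * layer (zeros y) a = 0.
Proof.
move=> inv two yx zy y1 x1 two_classes min.
pose B j := absc (pt y) j == absc (pt y) i1.
pose N := [set j | B j].
have yB j : B j -> pt y 0 j != 0.
  by move=> /eqP e; rewrite -normr_eq0 -[`|_|]/(absc _ _) e normr_eq0.
have [|w Dw wE] := @exists_sign_change y N (or_intror zy).
  by move=> i j ij yi yj; rewrite inE; apply/negP => /yB; rewrite yi eqxx.
pose t : 'rV[R]_n := \row_j if B j then pt y 0 j else 0.
have tE b : scoord t b = if B b.1 then scoord (pt y) b else 0 by apply: scoord_row.
have [z [z' [zz' yz yz']]] := two_zerosP _ zy.
have nBz : ~~ B z by apply/negP => /yB; rewrite yz eqxx.
have dB d b : zeros y \subset zeros d -> B b.1 ->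
    scoord (pt d) b = pt d 0 i1 / pt y 0 i1 * scoord (pt y) b.
  move=> yd Bb; suff : scoord (pt d) b * pt y 0 i1 = pt d 0 i1 * scoord (pt y) b.
    by move=> h; apply: (mulIf y1); rewrite h; field.
  case: (eqVneq b.1 i1) => [e|ne]; first by rewrite /scoord e; ring.
  have aux c : c.1 = i1 -> scoord (pt y) b = scoord (pt y) c -> scoord (pt d) b = scoord (pt d) c.
    move=> ec e; have /(subsetP yd) : (b, c) \in zeros y by rewrite in_zerov e eqxx orbT.
    by rewrite in_zerov ec (negbTE ne) /= => /eqP.
  have [e|e] := @eq_absc _ _ (pt y) b (i1, false) (eqP Bb).
    by rewrite (aux (i1, false)) // e !scoord_col !expr0 !mul1r.
  by rewrite (aux (sneg (i1, false))) // e !scoordN !scoord_col !expr0 !mul1r mulNr mulrN.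
have d0 d b : zeros y \subset zeros d -> pt y 0 b.1 = 0 -> scoord (pt d) b = 0.
  move=> yd yb; apply/eqP; rewrite scoord_eq0; apply/eqP.
  case: (eqVneq b.1 z) => [->|ne]; first exact: (zero_zerov yd zz').
  exact: (zero_zerov yd ne).
have i1z : i1 != z by apply: contraNneq y1 => ->; rewrite yz.
apply: (@flip_vector a x y t w (i1, false) (z, false)) => //.
- move=> b c; rewrite in_zerov => + ne; rewrite (negbTE ne) /= => /eqP e.
  by rewrite !tE /B (scoord_eq_absc e); case: ifP.
- rewrite in_zerov; apply/orP; right; rewrite !scoord_col x1.
  by rewrite (zero_zerov yx zz').
- by rewrite !tE /B eqxx -/(B z) (negbTE nBz) scoord_eq0.
move=> d yd; exists (pt d 0 i1 / pt y 0 i1) => b c xp ne.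
have val e : pt x 0 e.1 = 0 ->
    scoord (pt d) e = pt d 0 i1 / pt y 0 i1 * scoord t e /\
    (-1) ^+ (e.1 \in N) * scoord (pt d) e = - scoord (pt d) e.
  move=> xe; rewrite tE inE; case: (boolP (B e.1)) => Be.
    by rewrite (dB d e yd Be) expr1 mulN1r.
  have ye : pt y 0 e.1 = 0.
    by case: (two_classes _ xe) => // /eqP; rewrite -/(B _) (negbTE Be).
  by rewrite (d0 d e yd ye) !mulr0 oppr0.
have nB e : pt x 0 e.1 != 0 -> B e.1 = false.
  move=> xe; apply/negP => Be; case/negP: xe; rewrite -normr_eq0.
  by have := absc_zerov yx (eqP Be); rewrite /absc x1 normr0 => ->.
rewrite !wE //.
move: xp; rewrite in_zerov (negbTE ne) /= => /eqP xbc.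
have x0 : (pt x 0 b.1 == 0) = (pt x 0 c.1 == 0) by rewrite -!scoord_eq0 xbc.
case: (eqVneq (pt x 0 b.1) 0) x0 => [xb /esym/eqP xc|xb /esym/negbT xc]; last first.
  by rewrite !tE !inE !nB // eqxx !expr0 !mul1r.
have [hb ->] := val b xb; have [hc ->] := val c xc.
case: eqP => [e|_]; first by rewrite hb hc e !subrr.
by rewrite -opprD {1}hb {1}hc mulrBr.
Qed.

End Drop.

(** * Primitive idempotents and the radical *)

Section FiniteDimensional.
Variables (k : fieldType) (B : falgType k).
Implicit Types (a b e f : B).

(** More powers of [b] than the dimension are linearly dependent. Solving a relation for its lowest
    term gives [s] as a polynomial in [b]. *)
Lemma power_stable b : exists N s, GRing.comm b s /\ b ^+ N = b ^+ N.+1 * s.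
Proof.
set d := (\dim {:B}).+1; pose X := [tuple b ^+ i | i < d].
have nfree : ~~ free X.
  apply/negP; rewrite /free size_tuple => /eqP e.
  by have := dimvS (subvf <<X>>%VS); rewrite e ltnn.
have [c [c0 [i ci]]] : exists c : 'I_d -> k,
    \sum_(i < d) c i *: b ^+ i = 0 /\ exists i, c i != 0.
  apply: contrapT => h; case/negP: nfree; apply/freeP => c hc i.
  apply: contrapT => /eqP ci; apply: h; exists c; split; last by exists i.
  by rewrite -[RHS]hc; apply: eq_bigr => j _; rewrite -tnth_nth tnth_mktuple.
case: (@arg_minnP _ i (fun i => c i != 0) (fun i => nat_of_ord i) ci) => l cl min.
exists l, (\sum_(j < d | (l < j)%N) (- (c l)^-1 * c j) *: b ^+ (j - l.+1)); split.
  apply: commr_sum => j _; rewrite /GRing.comm -scalerAr -scalerAl.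
  by rewrite -exprS -exprSr.
apply: (scalerI cl); rewrite mulr_sumr scaler_sumr.
have := c0; rewrite (bigD1 l) //= => /eqP; rewrite addr_eq0 => /eqP->.
rewrite -sumrN (bigID (fun j : 'I_d => (l < j)%N)) /= [X in _ + X]big1 ?addr0.
  apply: eq_big => [j|j /andP[_ lj]]; first by rewrite andb_idl // => h; rewrite -val_eqE gtn_eqF.
  rewrite -scalerAr scalerA mulrA mulrN mulfV // mulN1r scaleNr -exprD subnKC //.
move=> j /andP[jl]; rewrite -leqNgt => lj; case: (eqVneq (c j) 0) => [->|/min h].
  by rewrite scale0r oppr0.
by case/eqP: jl; apply/val_inj/eqP; rewrite eqn_leq lj.
Qed.

(** Iterating [power_stable] yields the idempotent of the Fitting decomposition of [b]. The exponent
    is kept positive so that a character vanishing at [b] vanishes at [f]. *)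
Lemma fitting_idempotent b : exists M s, let f := b ^+ M.+1 * s in
  [/\ GRing.comm b s, Defs.idempotent f & b ^+ M.+1 = b ^+ M.+1 * f].
Proof.
have [N [s [bs e]]] := power_stable b.
have step j : b ^+ N.+1 = b ^+ (N.+1 + j) * s ^+ j.
  elim: j => [|j IH]; first by rewrite addn0 mulr1.
  rewrite {1}IH exprS mulrA; congr (_ * _).
  have -> : (N.+1 + j = j.+1 + N)%N by rewrite addnC addSnnS.
  by rewrite exprD e mulrA -exprD addnC addSnnS.
exists N, (s ^+ N.+1); rewrite /=.
have c1 : GRing.comm (b ^+ N.+1) (s ^+ N.+1).
  by apply: commrX; apply/commr_sym/commrX/commr_sym.
have c2 : b ^+ N.+1 * (b ^+ N.+1 * s ^+ N.+1) = b ^+ N.+1.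
  by rewrite mulrA -exprD -step.
split=> //; first exact: commrX.
by rewrite /Defs.idempotent -mulrA [s ^+ _ * _]mulrA -c1 mulrA c2.
Qed.

(** Otherwise the Fitting idempotent [f] of [e * a * e] has [chi1 f = 1] and [chi2 f = 0], and
    [e = f + (e - f)] contradicts primitivity. *)
Lemma primitive_char_sep e (chi1 chi2 : B -> k) a : primitive_idempotent e ->
  chi1 0 = 0 -> {morph chi1 : u v / u * v} -> {morph chi2 : u v / u * v} ->
  chi1 e = 1 -> chi2 e = 1 -> chi2 a = 0 -> chi1 a = 0.
Proof.
move=> [ee e0 prim] c0 m1 m2 e1 e2 a2; apply/eqP; apply/negPn/negP => a1.
have [b [eb be b1 b2]] : exists b, [/\ e * b = b, b * e = b, chi1 b != 0 & chi2 b = 0].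
  exists (e * a * e); rewrite !mulrA ee -[_ * e * e]mulrA ee; split=> //.
    by rewrite !m1 e1 mul1r mulr1.
  by rewrite !m2 a2 mulr0 mul0r.
have [M [s [bs ff bf]]] := fitting_idempotent b.
set f := b ^+ M.+1 * s in ff bf.
have ef : e * f = f by rewrite /f exprS !mulrA eb.
have fe : f * e = f.
  have fE : f = s * b ^+ M.+1 by rewrite /f; apply: commr_sym; apply: commrX; apply: commr_sym.
  by rewrite fE exprSr mulrA -mulrA be.
have bj j : chi1 (b ^+ j.+1) != 0.
  by elim: j => [|j IH]; rewrite ?expr1 // exprS m1 mulf_neq0.
have f1 : chi1 f = 1.
  by apply: (mulfI (bj M)); rewrite -m1 -bf mulr1.
have f2 : chi2 f = 0 by rewrite /f exprS !m2 b2 !mul0r.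
have [] := prim f (e - f).
- exact: ff.
- by rewrite /Defs.idempotent mulrBl !mulrBr ee ef fe ff subrr subr0.
- by rewrite mulrBr fe ff subrr.
- by rewrite mulrBl ef ff subrr.
- by rewrite addrC subrK.
- by move=> f0; move: f1; rewrite f0 c0 => /esym/eqP; rewrite oner_eq0.
move=> /eqP; rewrite subr_eq0 => /eqP ef'.
by move: f2; rewrite -ef' e2 => /eqP; rewrite oner_eq0.
Qed.

(** The kernel of a nonzero character is a left ideal of codimension one, hence maximal. *)
Lemma radical_char (chi : B -> k) r :
  (forall (c : k) a b, chi (c *: a + b) = c * chi a + chi b) ->
  {morph chi : u v / u * v} -> r \in radical B -> chi r = 0.
Proof.
move=> lin mul /radicalP rad.
case: (pselect (exists b, chi b != 0)) => [[b0 cb0]|no]; last first.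
  by apply: contrapT => /eqP h; apply: no; exists r.
have chi0 : chi 0 = 0 by have := lin (-1) 0 0; rewrite scaler0 addr0 mulN1r addNr.
have [|c a b a0 b0' |L LP] := @vspace_of_submod k B (fun a => chi a = 0).
- exact: chi0.
- by rewrite lin a0 b0' mulr0 addr0.
apply/LP; apply: rad; split.
- by apply/prodvP => u v _ /LP v0; apply/LP; rewrite mul v0 mulr0.
- by move=> Lf; have /LP/eqP : b0 \in L by [rewrite Lf memvf]; rewrite (negbTE cb0).
move=> L' _ LL'; case: (pselect (exists2 b, b \in L' & chi b != 0)) => [[b bL' cb]|no].
  right; apply/eqP; rewrite eqEsubv subvf; apply/subvP => a _.
  rewrite -(subrK ((chi a / chi b) *: b) a) addrC memvD ?memvZ //.
  apply: (subvP LL'); apply/LP; rewrite addrC -scaleNr lin.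
  by rewrite mulNr mulfVK // addNr.
left; apply/eqP; rewrite eqEsubv LL' andbT; apply/subvP => a aL'; apply/LP.
by apply: contrapT => /eqP h; apply: no; exists a.
Qed.

Lemma dim_mod_radical_gt0 a b (U : {vspace B}) :
  (0 < dim_mod (<[b]> * radical B * <[a]>)%VS U)%N ->
  exists2 r, r \in radical B & b * r * a != 0.
Proof.
move=> h; apply: contrapT => no; move: h; rewrite /dim_mod.
suff -> : (<[b]> * radical B * <[a]> = 0)%VS by rewrite add0v subnn.
apply/eqP; rewrite -subv0; apply/prodvP => u v hu /vlineP[c ->].
suff /subvP/(_ u hu) : (<[b]> * radical B <= lker (amulr a))%VS.
  rewrite memv_ker lfunE /= => /eqP ua.
  by rewrite -scalerAr ua scaler0 mem0v.
apply/prodvP => _ r /vlineP[c' ->] rr; rewrite memv_ker lfunE /=.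
rewrite -!scalerAl; apply/eqP; rewrite (_ : b * r * a = 0) ?scaler0 //.
by apply: contrapT => /eqP ne; apply: no; exists r.
Qed.

End FiniteDimensional.

(** * Stabilizers of flats and orbit sums *)

Section Invariants.
Variables (R : realFieldType) (k : fieldType) (n : nat).
Local Notation A := (face_alg R k n).
Local Notation fbase := (@fbase R k n).
Local Notation pt := (@face_pt R n).
Implicit Types (x y z : face R n) (a f u : A) (w : {perm sidx n}).

Lemma D_signed w : w \in Dgroup n -> signed_perm w.
Proof. by rewrite inE => /andP[]. Qed.

Lemma arrow_drop a f u : (2%:R : k) != 0 -> a \in invariants R k n -> a != 0 ->
  f * a = a -> a * u = a -> (forall S, chi S a = 0) ->
  exists x y, [/\ chi (zeros x) f = 1, chi (zeros y) u = 1 &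
                  (phi (pt x) + 2 <= phi (pt y))%N].
Proof.
move=> two inv a0 fa au chi0; have [y ay top] := top_face a0.
have lay0 : layer (zeros y) a != 0.
  apply/eqP => /ffunP/(_ y); rewrite !ffunE eqxx => e.
  by rewrite e eqxx in ay.
have [x [yx xa min]] := exists_layer_min lay0.
exists x, y; split.
- exact: (layer_min fa top yx xa min).
- exact: (chi_top au ay top).
(* Equality is excluded because all characters vanish on [a]. *)
have pr : zeros y \proper zeros x.
  rewrite properEneq yx andbT; apply: contra_neq xa => e.
  exact: layer_sum0.
case: (phi_drop pr) => //.
  move=> [i1 [i2 [x1 x12 y12 h par]]].
  by case/eqP: xa; apply: (split_zero inv two yx x1 x12 y12 h par min).
move=> [i [zy yi xi h]].
by case/eqP: xa; apply: (absorb_zero inv two yx zy yi xi h min).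
Qed.

(** Made into a group below so that its order divides that of [Dgroup n]. *)
Definition zeros_stab x : {set {perm sidx n}} :=
  [set w in Dgroup n | zeros (face_act w x) == zeros x].

Lemma zeros_stab_group_set x : group_set (zeros_stab x).
Proof.
apply/group_setP; split.
  rewrite inE group1; apply/eqP/setP => -[b c]; rewrite !inE sg_act; last first.
    by apply: D_signed; apply: group1.
  by rewrite invg1 !perm1.
move=> w w' /setIdP[Dw /eqP e] /setIdP[Dw' /eqP e'].
apply/setIdP; split; first exact: groupM.
apply/eqP.
rewrite -face_actMg ?D_signed // -[RHS]e'; apply/setP => p.
rewrite !inE !sg_act ?D_signed //.
by move/setP: e => /(_ ((w'^-1)%g p.1, (w'^-1)%g p.2)); rewrite !inE !sg_act ?D_signed.
Qed.

Canonical zeros_stab_group x := Group (zeros_stab_group_set x).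

Definition orbit_sum x : A := \sum_(w in Dgroup n) fbase (face_act w x).

Lemma orbit_sum_invariant x : orbit_sum x \in invariants R k n.
Proof.
apply/invariantsP => w Dw; rewrite /orbit_sum.
pose f : {linear A -> A} := alg_act w; rewrite -[LHS]/(f _) linear_sum.
rewrite [RHS](reindex_inj (mulIg w)) /=; apply: eq_big => [v|v Dv].
  by rewrite groupMr.
by rewrite alg_act_base face_actMg ?D_signed.
Qed.

Lemma chi_orbit_sum S x :
  chi S (orbit_sum x) = #|[set w in Dgroup n | S \subset zeros (face_act w x)]|%:R :> k.
Proof.
pose f : {linear A -> k | *%R} := chi S.
rewrite -[LHS]/(f _) linear_sum -sum1_card natr_sum /=.
rewrite [RHS](eq_bigl (fun w => (w \in Dgroup n) && (S \subset zeros (face_act w x)))).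
  by rewrite [RHS]big_mkcondr; apply: eq_bigr => w _; rewrite chi_base; case: ifP.
by move=> w; rewrite in_set.
Qed.

Hypothesis hk : [pchar k] =i pred0 \/
  exists2 p, p \in [pchar k] & ~~ (p %| #|Dgroup n|)%N.

Lemma natr_divisor_neq0 d : (d %| #|Dgroup n|)%N -> (d%:R : k) != 0.
Proof.
move=> dD; have d0 : (0 < d)%N by apply: dvdn_gt0 dD; apply: cardG_gt0.
case: hk => [/pcharf0P->|[p pk ndv]]; first by rewrite -lt0n.
rewrite -(dvdn_pcharf pk); apply: contra ndv => pd; exact: dvdn_trans pd dD.
Qed.

(** The value is the order of the stabilizer of the flat: translates have equally many zeros, so an
    inclusion is an equality. *)
Lemma chi_orbit_sum_neq0 x : chi (zeros x) (orbit_sum x) != 0.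
Proof.
rewrite chi_orbit_sum; apply: natr_divisor_neq0.
have -> : [set w in Dgroup n | zeros x \subset zeros (face_act w x)] = zeros_stab_group x.
  apply/setP => w; rewrite [LHS]in_set [RHS]in_set; apply: andb_id2l => /D_signed sw.
  by rewrite eq_sym eqEcard card_zeros_act // leqnn andbT.
by apply: cardSg; apply/subsetP => w /setIdP[].
Qed.

End Invariants.

(** * Paths in the quiver *)

Section Quiver.
Variables (R : realFieldType) (k : fieldType) (n : nat).
Local Notation IA := (subvs_of (invariant_alg R k n)).
Local Notation pt := (@face_pt R n).
Implicit Types (x y : face R n) (e a : IA) (S : {set sidx n * sidx n}).

Hypothesis hk : [pchar k] =i pred0 \/
  exists2 p, p \in [pchar k] & ~~ (p %| #|Dgroup n|)%N.

Definition ichi S a : k := chi S (vsval a).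

Lemma ichiM S : {morph ichi S : a b / a * b}.
Proof. by move=> a b; rewrite /ichi -chiM. Qed.

Lemma ichi_lin S (c : k) a b : ichi S (c *: a + b) = c * ichi S a + ichi S b.
Proof. by rewrite /ichi !linearP. Qed.

Lemma ichi0 S : ichi S 0 = 0.
Proof. by rewrite /ichi !linear0. Qed.

(** Apply [primitive_char_sep] to the orbit sum of [x]: its character at [zeros x] is nonzero, and
    its character at [zeros y] would be 0 if no translate of [x] lay in the flat of [y]. *)
Lemma orbit_le e x y : primitive_idempotent e ->
  ichi (zeros x) e = 1 -> ichi (zeros y) e = 1 ->
  exists2 w, w \in Dgroup n & zeros y \subset zeros (face_act w x).
Proof.
move=> pe ex ey; apply: contrapT => no.
pose a : IA := Subvs (orbit_sum_invariant k x).
have : ichi (zeros x) a = 0.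
  apply: (primitive_char_sep pe (ichi0 _) (ichiM _) (ichiM (zeros y)) ex ey).
  rewrite /ichi /= chi_orbit_sum (_ : [set w in _ | _] = set0) ?cards0 //.
  apply/setP => w; rewrite in_set0; apply/negP => /setIdP[Dw h].
  by apply: no; exists w.
by apply/eqP; apply: chi_orbit_sum_neq0.
Qed.

(** Inclusions both ways between translates make the numbers of zeros equal, so the two flats lie in
    one orbit. *)
Lemma phi_vertex e x y : primitive_idempotent e ->
  ichi (zeros x) e = 1 -> ichi (zeros y) e = 1 -> phi (pt x) = phi (pt y).
Proof.
move=> pe ex ey.
have [w Dw yx] := orbit_le pe ex ey; have [w' Dw' xy] := orbit_le pe ey ex.
rewrite -(phi_act x (D_signed Dw)); apply: phi_zerov; rewrite -!zerosE.
apply/esym/eqP; rewrite eqEcard yx card_zeros_act ?D_signed //.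
by rewrite -(card_zeros_act y (D_signed Dw')) subset_leq_card.
Qed.

Lemma quiver_arrow (I : finType) (e : I -> IA) (i j : I) : (2%:R : k) != 0 ->
  complete_system e -> (0 < narrows (i : vertex (alg_quiver e)) j)%N ->
  exists x y, [/\ ichi (zeros x) (e j) = 1, ichi (zeros y) (e i) = 1 &
                  (phi (pt x) + 2 <= phi (pt y))%N].
Proof.
move=> two [prim _ _] /dim_mod_radical_gt0[r rr ne].
have [ei _ _] := prim i; have [ej _ _] := prim j.
pose a := e j * r * e i.
apply: (@arrow_drop R k n (vsval a)) => //.
- exact: subvsP.
- by rewrite -[LHS]/(vsval (e j * a)) /a !mulrA ej.
- by rewrite -[LHS]/(vsval (a * e i)) /a -mulrA ei.
move=> S; rewrite -/(ichi S a) /a !ichiM (radical_char (@ichi_lin S) (ichiM S) rr).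
by rewrite mulr0 mul0r.
Qed.

(** Consecutive arrows may supply different flats at their common vertex; [phi_vertex] equates the
    potentials of these flats, so the drops of two add up. *)
Lemma path_phi (I : finType) (e : I -> IA) (b : arrow (alg_quiver e)) p x :
  (2%:R : k) != 0 -> complete_system e -> is_path (b :: p) ->
  ichi (zeros x) (e (source b)) = 1 -> (2 * (size p).+1 <= phi (pt x))%N.
Proof.
move=> two he; have [prim _ _] := he.
elim: p b x => [|c p IH] b x hp ex;
  have [] := @quiver_arrow I e (source b) (target b) two he (leq_ltn_trans (leq0n _) (ltn_ord (tagged b)));
  move=> x' [y [ex' ey drop]]; rewrite (phi_vertex (prim _) ex ey); apply: leq_trans drop.
  by rewrite leq_addl.
rewrite mulnS addnC leq_add2r.
move: hp => /= /andP[/eqP bc hp].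
by apply: (IH c x') => //; rewrite -bc.
Qed.

End Quiver.

(** Negating two coordinates is an involution of the group; this is what makes 2 nonzero in [k]. *)
Lemma two_dvd_Dgroup n : (1 < n)%N -> (2 %| #|Dgroup n|)%N.
Proof.
move=> n1; pose i0 : 'I_n := Ordinal (ltnW n1); pose i1 : 'I_n := Ordinal n1.
pose w := neg_perm [set i0; i1].
have Dw : w \in Dgroup n by apply: neg_perm_D; rewrite cards2.
suff <- : #[w]%g = 2%N by apply: order_dvdG.
apply: nt_prime_order => //.
  by apply/permP => a; rewrite expgS expg1 permM perm1 !neg_permE flipK.
by apply/eqP => /permP/(_ (i0, false)); rewrite neg_permE perm1 /flip /= !inE eqxx.
Qed.

Theorem proposition6p4 (R : realType) (k : fieldType) (m : nat) (hm : (1 <= m)%N)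
    (hk : [pchar k] =i pred0 \/
          exists2 p, p \in [pchar k] & ~~ (p %| #|Dgroup (2 * m + 1)|)%N)
    (I : finType) (e : I -> subvs_of (invariant_alg R k (2 * m + 1)))
    (he : complete_system e)
    (p : seq (arrow (alg_quiver e))) (hp : is_path p) :
  (size p <= m + 1)%N.
Proof.
have two : (2%:R : k) != 0.
  apply: (natr_divisor_neq0 hk); apply: two_dvd_Dgroup.
  by rewrite addn1 ltnS muln_gt0.
case: p hp => [//|b p] hp.
(* The first arrow provides a starting flat; its potential is at most (2m + 1) + 1 = 2 (m + 1). *)
have [x' [y [_ ey _]]] := quiver_arrow two he (leq_ltn_trans (leq0n _) (ltn_ord (tagged b))).
have := leq_trans (path_phi hk two he hp ey) (phi_le _).
by rewrite -addnA -[(1 + 1)%N]/(2 * 1)%N -mulnDr leq_pmul2l.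
Qed.
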